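(* Let $X$ be the Markov mixture process on $\mathbb{S}=E\cup\{\Delta\}$, let $\Gamma_1,\Gamma_2$ be stochastically closed subsets of $\mathbb{S}$ with $\Gamma_1\cap\Gamma_2=\{\Delta\}$, $\tau_l=\inf\{t\ge0:X_t\in\Gamma_l\}$, and $\overline F_t(t_1,t_2)=\mathbb{P}\{\tau_1>t_1,\tau_2>t_2\mid\mathcal{G}_t\}$ for $t_1,t_2\ge t\ge0$. For $t\ge0$ the $\mathcal{G}_t$-conditional density $f_t(t_1,t_2)$ of $(\tau_1,\tau_2)$, i.e. of the measure $d\overline F_t$, is $$f_t(t_1,t_2)=\begin{cases}f^{(1)}_t(t_1,t_2),&t_1>t_2>t,\\ f^{(2)}_t(t_1,t_2),&t_2>t_1>t,\\ f^{(0)}_t(t_1,t_1),&t_1=t_2>t,\\ 1-\boldsymbol\pi^{\top}(t)\mathbf{H}_2\mathbf{H}_1\mathbb{1},&t_1=t_2=t,\end{cases}$$ where $f^{(1)}_t,f^{(2)}_t$ are densities with respect to $dt_1dt_2$ (absolutely continuous part), $f^{(0)}_t(t_1,t_1)$ is a density with respect to $dt_1$ on the diagonal $\{t_1=t_2>t\}$ (singular part), and the last line is a point mass at $(t,t)$; here $$f^{(1)}_t(t_1,t_2)=\sum_{k=1}^m\boldsymbol\pi^{\top}(t)\mathbf{S}^{(k)}(t)e^{\mathbf{B}^{(k)}(t_2-t)}\big[\mathbf{B}^{(k)},\mathbf{H}_2\big]e^{\mathbf{B}^{(k)}(t_1-t_2)}\mathbf{B}^{(k)}\mathbf{H}_1\mathbb{1},$$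 $$f^{(2)}_t(t_1,t_2)=\sum_{k=1}^m\boldsymbol\pi^{\top}(t)\mathbf{S}^{(k)}(t)e^{\mathbf{B}^{(k)}(t_1-t)}\big[\mathbf{B}^{(k)},\mathbf{H}_1\big]e^{\mathbf{B}^{(k)}(t_2-t_1)}\mathbf{B}^{(k)}\mathbf{H}_2\mathbb{1},$$ $$f^{(0)}_t(t_1,t_1)=\sum_{k=1}^m\boldsymbol\pi^{\top}(t)\mathbf{S}^{(k)}(t)e^{\mathbf{B}^{(k)}(t_1-t)}\Big(\big[\mathbf{B}^{(k)},\mathbf{H}_2\big]\mathbf{H}_1+\big[\mathbf{B}^{(k)},\mathbf{H}_1\big]\mathbf{H}_2-\mathbf{B}^{(k)}\mathbf{H}_2\mathbf{H}_1\Big)\mathbb{1},$$ with $[A,B]=AB-BA$ the commutator.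
   Context: Mixture process: $E=\{1,\dots,n\}$ are the transient states, $\Delta=n+1$ is the absorbing state, $\mathbb{S}=E\cup\{\Delta\}$. For $k=1,\dots,m$, $\mathbf{Q}^{(k)}=\begin{pmatrix}\mathbf{B}^{(k)}&-\mathbf{B}^{(k)}\mathbb{1}\\ \mathbf{0}&0\end{pmatrix}$ is an intensity matrix on $\mathbb{S}$ (nonnegative off-diagonal entries, zero row sums) with $\mathbf{B}^{(k)}$ an $n\times n$ nonsingular matrix. On a probability space there are an unobserved regime $\phi\in\{1,\dots,m\}$ and an $\mathbb{S}$-valued right-continuous process $X=(X_t)_{t\ge0}$ such that $\mathbb{P}\{X_0=i\}=\pi_i$ for $i\in E$, $\mathbb{P}\{X_0=\Delta\}=0$, $\mathbb{P}\{\phi=k\mid X_0=i\}=s_i^{(k)}$ with $\sum_k s_i^{(k)}=1$, and, given $\phi=k$ and $X_0=i$, $X$ is a time-homogeneous Markov jump process with intensity matrix $\mathbf{Q}^{(k)}$ started at $i$. Closed sets: $\Gamma_l$ stochastically closed means $[\mathbf{Q}^{(k)}]_{i,j}=0$ for all $k$ whenever $i\in\Gamma_l$, $j\in\Gamma_l^c$. It is assumed that $\pi_i\ne0$ for $i\in\Gamma_1^c\cap\Gamma_2^c$ and $\mathbb{P}\{\tau_1>0,\tau_2>0\}=1$. $\mathbf{H}_l$ is the $n\times n$ diagonal matrix with $[\mathbf{H}_l]_{ii}=1$ if $i\in\Gamma_l^c$ and $0$ otherwise, $i\in E$. Information: $\mathcal{F}_{t-}$ is any sub-$\sigma$-field of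 $\sigma(X_s:0\le s<t)$ (full, partial, or no information). $\mathcal{F}_{t,i}$ denotes $\mathcal{F}_{t-}$ together with $X_t=i$: $\mathbb{P}\{A\mid\mathcal{F}_{t,i}\}:=\mathbb{P}\{A\cap\{X_t=i\}\mid\mathcal{F}_{t-}\}/\mathbb{P}\{X_t=i\mid\mathcal{F}_{t-}\}$ where the denominator is positive. $\mathcal{G}_t$ is either $\mathcal{F}_{t-}$ together with the event $X_t\ne\Delta$, meaning $\mathbb{P}\{A\mid\mathcal{G}_t\}:=\mathbb{P}\{A\cap\{X_t\ne\Delta\}\mid\mathcal{F}_{t-}\}/\mathbb{P}\{X_t\ne\Delta\mid\mathcal{F}_{t-}\}$ where the denominator is positive, or simply $\mathcal{G}_t=\mathcal{F}_{t-}$. Identities are almost sure, where defined. $\boldsymbol\pi(t)=(\pi_1(t),\dots,\pi_n(t))^\top$ with $\pi_i(t)=\mathbb{P}\{X_t=i\mid\mathcal{G}_t\}$; $\mathbf{S}^{(k)}(t)=\mathrm{diag}(s_1^{(k)}(t),\dots,s_n^{(k)}(t))$ with $s_i^{(k)}(t)=\mathbb{P}\{\phi=k\mid\mathcal{F}_{t,i}\}$ (completed arbitrarily to nonnegative weights summing to $1$ over $k$ where undefined). $\mathbb{1}$ is the all-ones vector. The measure $d\overline F_t$: the probability measure on $\{(t,t)\}\cup(t,\infty)^2$ giving mass $\overline F_t(t_1,t_2)$ to $(t_1,\infty)\times(t_2,\infty)$ for all $t_1,t_2\ge t$; thus the residual mass $1-\overline F_t(t,t)$ is placed at the point $(t,t)$.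 *)

(* Defs.v *)
From HB Require Import structures.
From mathcomp Require Export all_boot all_order all_algebra.
From mathcomp Require Export all_classical all_reals all_analysis.
Export Order.TTheory GRing.Theory Num.Theory.
Export numFieldNormedType.Exports.

Set Implicit Arguments.
Unset Strict Implicit.
Unset Printing Implicit Defensive.

Local Open Scope classical_set_scope.
Local Open Scope ring_scope.

(** * Matrices *)

(* The exponential series, with its limit taken entry by entry. *)
Definition expm (R : realType) (n : nat) (A : 'M[R]_n) : 'M[R]_n :=
  \matrix_(i, j) limn (series (fun l : nat => (A ^+ l) i j / (l`!)%:R)).

Definition commutator (R : realType) (n : nat) (A B : 'M[R]_n) : 'M[R]_n :=
  A *m B - B *m A.

Definition ones (R : realType) (n : nat) : 'cV[R]_n := const_mx 1.

Definition intensity_matrix (R : realType) (n : nat) (Q : 'M[R]_n) : Prop :=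
  (forall i j, i != j -> 0 <= Q i j) /\ (forall i, \sum_j Q i j = 0).

(** * State space: E = {1..n} is ['I_n], and S is ['I_(n + 1)], so that
    (n + 1) x (n + 1) matrices decompose into blocks along E and Delta. *)

Definition state (n : nat) := 'I_(n + 1).
Definition transient (n : nat) (i : 'I_n) : state n := lshift 1 i.
Definition Delta (n : nat) : state n := rshift n ord0.

Definition absorbing_Q (R : realType) (n : nat) (B : 'M[R]_n) :
    'M[R]_(n + 1) :=
  block_mx B (- (B *m ones R n)) 0 0.

Definition stochastically_closed (R : realType) (n m : nat)
    (B : 'I_m -> 'M[R]_n) (Gam : {set state n}) : Prop :=
  forall (k : 'I_m) (i j : state n),
    i \in Gam -> j \notin Gam -> absorbing_Q (B k) i j = 0.

Definition Hmx (R : realType) (n : nat) (Gam : {set state n}) : 'M[R]_n :=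
  diag_mx (\row_i (transient i \notin Gam)%:R).

(** * Markov jump processes and the mixture process *)

(* Elementary conditional probability; used only when P C > 0. *)
Definition pcond (d : measure_display) (T : measurableType d) (R : realType)
    (P : probability T R) (C A : set T) : R :=
  fine (P (A `&` C)) / fine (P C).

(* Under the (real-valued) law p, X is started at i, has the Markov property and
   transition matrices exp(hQ), h >= 0. *)
Definition markov_jump_process (T : Type) (R : realType) (n : nat)
    (p : set T -> R) (X : R -> T -> 'I_n) (Q : 'M[R]_n) (i : 'I_n) : Prop :=
  p [set w | X 0 w = i] = 1 /\
  forall (N : nat) (u : nat -> R) (x : nat -> 'I_n),
    0 <= u 0%N -> (forall l, (l <= N)%N -> u l <= u l.+1) ->
    let past := [set w | forall l, (l <= N)%N -> X (u l) w = x l] in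
    0 < p past ->
    p ([set w | X (u N.+1) w = x N.+1] `&` past) / p past
      = expm ((u N.+1 - u N) *: Q) (x N) (x N.+1).

Record mixture_process (d : measure_display) (T : measurableType d)
    (R : realType) (P : probability T R) (n m : nat)
    (B : 'I_m -> 'M[R]_n) (p0 : 'I_n -> R) (s0 : 'I_n -> 'I_m -> R)
    (phi : T -> 'I_m) (X : R -> T -> state n) : Prop := MixtureProcess {
  mix_intensity : forall k, intensity_matrix (absorbing_Q (B k));
  mix_nonsingular : forall k, B k \in unitmx;
  mix_phi_measurable : forall k, measurable [set w | phi w = k];
  mix_X_measurable : forall t j, 0 <= t -> measurable [set w | X t w = j];
  mix_right_continuous : forall t w, 0 <= t ->
    \forall u \near t^'+, X u w = X t w;
  mix_initial : forall i, P [set w | X 0 w = transient i] = (p0 i)%:E;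
  mix_initial_Delta : P [set w | X 0 w = Delta n] = 0%E;
  mix_regime : forall i k, p0 i != 0 ->
    pcond P [set w | X 0 w = transient i] [set w | phi w = k] = s0 i k;
  mix_regime_sum : forall i, \sum_k s0 i k = 1;
  mix_markov : forall k i,
    let C := [set w | phi w = k] `&` [set w | X 0 w = transient i] in
    (0 < P C)%E ->
    markov_jump_process (pcond P C) X (absorbing_Q (B k)) (transient i)
}.

(* With the convention inf(empty set) = +oo. *)
Definition hitting_time (T : Type) (R : realType) (n : nat)
    (X : R -> T -> state n) (Gam : {set state n}) (w : T) : \bar R :=
  ereal_inf [set u%:E | u in [set u : R | 0 <= u /\ X u w \in Gam]].

(** * Conditioning *)

(* The sigma-field generated by X_u, 0 <= u < t. *)
Definition strict_past (T : Type) (R : realType) (n : nat)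
    (X : R -> T -> state n) (t : R) : set (set T) :=
  <<s [set A | exists u j, [/\ 0 <= u, u < t & A = [set w | X u w = j]] ]>>.

(* Y is a version of P{A | F}. *)
Definition cond_prob (d : measure_display) (T : measurableType d)
    (R : realType) (P : probability T R) (F : set (set T)) (A : set T)
    (Y : T -> R) : Prop :=
  [/\ forall V : set (measurableTypeR R), measurable V -> F (Y @^-1` V),
      P.-integrable setT (EFin \o Y)
    & forall C, F C -> (\int[P]_(w in C) (Y w)%:E = P (A `&` C))%E].

(* Y is a version of P{A | F together with the event D}, that is of
   P{A /\ D | F} / P{D | F} where the denominator is positive; Y is
   unconstrained elsewhere. *)
Definition cond_prob_on (d : measure_display) (T : measurableType d)
    (R : realType) (P : probability T R) (F : set (set T)) (D A : set T)
    (Y : T -> R) : Prop :=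
  exists num den : T -> R,
    [/\ cond_prob P F (A `&` D) num, cond_prob P F D den
      & {ae P, forall w, 0 < den w -> Y w = num w / den w}].

(* The two choices of G_t: F_{t-} alone, or with the event X_t <> Delta. *)
Inductive info := PastOnly | PastAndAlive.

Definition alive (T : Type) (R : realType) (n : nat)
    (X : R -> T -> state n) (t : R) : set T := [set w | X t w <> Delta n].

(* Y is a version of P{A | G_t}. *)
Definition cond_prob_G (d : measure_display) (T : measurableType d)
    (R : realType) (P : probability T R) (n : nat) (X : R -> T -> state n)
    (t : R) (F : set (set T)) (g : info) (A : set T) (Y : T -> R) : Prop :=
  match g with
  | PastOnly => cond_prob P F A Y
  | PastAndAlive => cond_prob_on P F (alive X t) A Y
  end.

(* Where G_t-conditional probabilities are defined; a is a version of
   P{X_t <> Delta | F_{t-}}. *)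
Definition G_defined (T : Type) (R : realType) (g : info) (a : T -> R)
    (w : T) : Prop :=
  match g with
  | PastOnly => True
  | PastAndAlive => 0 < a w
  end.

(** * The measure dF_t and its density *)

Definition upper_right (R : realType) (t1 t2 : R) :
    set (measurableTypeR R * measurableTypeR R) :=
  [set x | t1 < x.1 /\ t2 < x.2].

(* mu w is the measure dF_t for almost every w in Def, where Fbar t1 t2 is a
   version of P{tau_1 > t1, tau_2 > t2 | G_t}.  As each Fbar t1 t2 is only
   determined up to a null set, which may depend on (t1, t2), the exceptional
   set in the second clause must be allowed to depend on (t1, t2). *)
Definition is_dFbar (d : measure_display) (T : measurableType d)
    (R : realType) (P : probability T R) (Def : T -> Prop) (t : R)
    (Fbar : R -> R -> T -> R)
    (mu : T -> probability (measurableTypeR R * measurableTypeR R)%type R) :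
    Prop :=
  {ae P, forall w, Def w -> mu w ([set (t, t)] `|` upper_right t t) = 1%E} /\
  forall t1 t2 : R, t <= t1 -> t <= t2 ->
    {ae P, forall w, Def w -> mu w (upper_right t1 t2) = (Fbar t1 t2 w)%:E}.

(* f is a density of mu on {(t,t)} U (t,oo)^2: with respect to dt1 dt2 off the
   diagonal, to dt1 on the diagonal {t1 = t2 > t}, and to the unit point mass
   at (t,t). *)
Definition has_density (R : realType) (t : R)
    (f : measurableTypeR R * measurableTypeR R -> R)
    (mu : probability (measurableTypeR R * measurableTypeR R)%type R) : Prop :=
  [/\ measurable_fun setT f, (forall x, 0 <= f x)
    & forall A, measurable A ->
      mu A =
        ((\int[lebesgue_measure \x lebesgue_measure]_(x in
              A `&` upper_right t t `&` [set x | x.1 <> x.2]) (f x)%:E)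
         + (\int[lebesgue_measure]_(u in
              [set u : measurableTypeR R | (t < u)%R /\ A (u, u)])
              (f (u, u))%:E)
         + (f (t, t) * \1_A (t, t))%:E)%E].

Section Formulas.
Context (R : realType) (n m : nat) (B : 'I_m -> 'M[R]_n)
  (Gam1 Gam2 : {set state n}) (t : R)
  (pit : 'cV[R]_n) (St : 'I_m -> 'M[R]_n).

Let H1 : 'M[R]_n := Hmx R Gam1.
Let H2 : 'M[R]_n := Hmx R Gam2.

Definition density1 (t1 t2 : R) : R :=
  \sum_k (pit^T *m St k *m expm ((t2 - t) *: B k) *m commutator (B k) H2
     *m expm ((t1 - t2) *: B k) *m B k *m H1 *m ones R n) ord0 ord0.

Definition density2 (t1 t2 : R) : R :=
  \sum_k (pit^T *m St k *m expm ((t1 - t) *: B k) *m commutator (B k) H1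
     *m expm ((t2 - t1) *: B k) *m B k *m H2 *m ones R n) ord0 ord0.

Definition density0 (t1 : R) : R :=
  \sum_k (pit^T *m St k *m expm ((t1 - t) *: B k)
     *m (commutator (B k) H2 *m H1 + commutator (B k) H1 *m H2
         - B k *m H2 *m H1) *m ones R n) ord0 ord0.

Definition point_mass : R := 1 - (pit^T *m H2 *m H1 *m ones R n) ord0 ord0.

Definition density (x : measurableTypeR R * measurableTypeR R) : R :=
  let: (t1, t2) := x in
  if (t < t2) && (t2 < t1) then density1 t1 t2
  else if (t < t1) && (t1 < t2) then density2 t1 t2
  else if (t1 == t2) && (t < t1) then density0 t1
  else if (t1 == t) && (t2 == t) then point_mass
  else 0.

End Formulas.

(* Main.v *)
From HB Require Import structures.
Require Import Defs.
From mathcomp Require Import ring measurable_realfun.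

(* The conditional survival function of (tau_1, tau_2) is computed in two ways.

   Probabilistically: the Markov property, known on finite-dimensional cylinders
   given the regime and the initial state, extends to the strict past by a
   pi-lambda argument.  As the sets are closed and paths are right-continuous,
   {tau_l > u} = {X_u not in Gam_l} almost surely, so that on t <= t2 <= t1
     P{tau_1 > t1, tau_2 > t2 | G_t} = sum_k pi^T S_k e^{(t2-t)B} H2 e^{(t1-t2)B} H1 1.

   Analytically: e^{sB} [B, H] e^{(c-s)B} is the s-derivative of
   e^{sB} H e^{(c-s)B}, and e^{sB} -> 0 because B is nonsingular, so the integral
   of the density over a quadrant telescopes to the same expression.  The density
   is nonnegative because closedness forces the sign of each kernel, hence it
   defines a probability measure, and a probability measure on
   {(t,t)} U (t,oo)^2 is determined by countably many quadrants; this is what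
   allows the exceptional null sets to be merged into one. *)

Set Implicit Arguments.
Unset Strict Implicit.
Unset Printing Implicit Defensive.

Local Open Scope classical_set_scope.
Local Open Scope ring_scope.

(** * The matrix exponential *)

Section Exponential.
Context (R : realType) (n : nat).
Implicit Types (A B : 'M[R]_n) (s x : R) (i j : 'I_n).

(** Below the diagonal the telescoping does not close: besides e^{(t2-t)B} H2 e^{(t1-t2)B} H1 1 it
    leaves B^-1 H2 B H1 1, carried to the time max(t1, t2), and the part above the diagonal leaves
    the mirror term. The kernel of [density0] is what cancels both, so the mass of a quadrant comes
    out only when the three integrals are added.

    Conditional probabilities are arbitrary where their denominator vanishes. The s_i^(k)(t) are
    therefore used only through the products s_i^(k)(t) P{X_t = i | F}, which are versions of P{phi
    = k, X_t = i | F} even where the second factor is 0, and both choices of G_t become division of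
    F-conditional probabilities by one weight. Once w is fixed outside a null set, pi(t) is a
    subprobability vector, the s_i^(k)(t) sum to 1 over k, and what remains is analysis without any
    conditioning. *)

Lemma norm_expmx_entry_le A l i j :
  `|(A ^+ l) i j| <= (\sum_i \sum_j `|A i j|) ^+ l.
Proof.
elim: l i j => [|l IHl] i j.
  by rewrite !expr0 mxE; case: (i == j); rewrite ?normr1 ?normr0.
rewrite !exprS mxE (le_trans (ler_norm_sum _ _ _))//.
apply: (@le_trans _ _ (\sum_k `|A i k| * (\sum_i \sum_j `|A i j|) ^+ l)).
  by apply: ler_sum => k _; rewrite normrM ler_wpM2l.
rewrite -mulr_suml ler_wpM2r ?exprn_ge0//.
  by apply: sumr_ge0 => ? _; apply: sumr_ge0.
by rewrite [leRHS](bigD1 i)//= lerDl; apply: sumr_ge0 => ? _; apply: sumr_ge0.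
Qed.

(** Coefficients of an entry of e^{xA} as a scalar power series in x, so that convergence and
    termwise differentiation are those of scalar series. *)
Definition exp_coef A i j (l : nat) : R := (A ^+ l) i j / l`!%:R.

Lemma exp_coef_diffs A i j :
  pseries_diffs (exp_coef A i j) =
  fun l => \sum_k A i k * exp_coef A k j l.
Proof.
apply/funext => l; rewrite /pseries_diffs /exp_coef exprS mxE factS natrM invfM.
by rewrite mulrCA mulVKf ?pnatr_eq0// mulr_suml; apply: eq_bigr => k _; rewrite mulrA.
Qed.

(** Dominated by the scalar exponential series at M |x|, with M the sum of the absolute values of
    all entries of A. *)
Lemma is_cvg_pseries_exp_coef A i j x : cvgn (pseries (exp_coef A i j) x).
Proof.
set M := \sum_i \sum_j `|A i j|.
apply: normed_cvg.
apply: (@series_le_cvg _ _ (exp_coeff (M * `|x|))).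
- by move=> l; exact: normr_ge0.
- move=> l; rewrite /exp_coeff/= mulr_ge0// exprn_ge0// mulr_ge0//.
  by apply: sumr_ge0 => ? _; apply: sumr_ge0.
- move=> l; rewrite /exp_coeff/exp_coef/= !normrM normfV normr_nat normrX.
  rewrite exprMn mulrAC ler_wpM2r// ler_wpM2r ?exprn_ge0//.
  exact: norm_expmx_entry_le.
- exact: is_cvg_series_exp_coeff.
Qed.

Lemma exprmxZ A s l : (s *: A) ^+ l = s ^+ l *: A ^+ l.
Proof.
elim: l => [|l IHl]; first by rewrite !expr0 scale1r.
rewrite !exprS IHl; change ((s *: A) *m (s ^+ l *: A ^+ l) = (s * s ^+ l) *: (A *m A ^+ l)).
by rewrite -scalemxAr -scalemxAl scalerA mulrC.
Qed.

Lemma expmZE A s i j : expm (s *: A) i j = limn (pseries (exp_coef A i j) s).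
Proof.
rewrite mxE /pseries; congr (limn (series _)); apply/funext => l.
by rewrite exprmxZ mxE /exp_coef -mulrA mulrC.
Qed.

Lemma cvg_sum_pseries (c : 'I_n -> R) (f : 'I_n -> nat -> R) x :
  (forall k, cvgn (pseries (f k) x)) ->
  pseries (fun l => \sum_k c k * f k l) x @ \oo -->
  \sum_k c k * limn (pseries (f k) x).
Proof.
move=> cf.
have -> : pseries (fun l => \sum_k c k * f k l) x =
    fun N => \sum_k c k * pseries (f k) x N.
  apply/funext => N; rewrite /pseries /series/=.
  under eq_bigr do rewrite mulr_suml.
  rewrite exchange_big/=; apply: eq_bigr => k _.
  by rewrite mulr_sumr; apply: eq_bigr => l _; rewrite mulrA.
by apply: cvg_big => [|k _]; [exact: add_continuous|apply: cvgMl_tmp; exact: cf].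
Qed.

(** Each formal derivative of the series multiplies its coefficients by A on the left, so the first
    one sums to an entry of A e^{xA} and the second involves A^2. *)
Lemma is_derive_expm A x i j :
  is_derive x 1 (fun s => expm (s *: A) i j) ((A *m expm (x *: A)) i j).
Proof.
have cvgD (c : 'I_n -> 'I_n -> R) a b y :
    cvgn (pseries (fun l => \sum_k c a k * exp_coef A k b l) y).
  by apply/cvg_ex; eexists; apply: cvg_sum_pseries => k; exact: is_cvg_pseries_exp_coef.
have -> : (fun s => expm (s *: A) i j) = fun s => limn (pseries (exp_coef A i j) s).
  by apply/funext => s; rewrite expmZE.
have -> : (A *m expm (x *: A)) i j = limn (pseries (pseries_diffs (exp_coef A i j)) x).
  rewrite exp_coef_diffs; apply/esym/cvg_lim => //.
  rewrite mxE (eq_bigr (fun k => A i k * limn (pseries (exp_coef A k j) x))).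
    by apply: cvg_sum_pseries => k; exact: is_cvg_pseries_exp_coef.
  by move=> k _; rewrite expmZE.
(* Differentiation at x asks for convergence of the series and of its first two formal derivatives
   at a point of larger modulus; the series converge everywhere, so |x| + 1 serves. *)
apply: (@pseries_snd_diffs _ _ (`|x| + 1)).
- exact: is_cvg_pseries_exp_coef.
- by rewrite exp_coef_diffs; exact: (cvgD (fun a b => A a b)).
- have -> : pseries_diffs (pseries_diffs (exp_coef A i j)) =
      fun l => \sum_k (A ^+ 2) i k * exp_coef A k j l.
    apply/funext => l.
    rewrite /pseries_diffs [_.+1.+1%:R * _](_ : _ = pseries_diffs (exp_coef A i j) l.+1)//.
    rewrite exp_coef_diffs mulr_sumr.
    under eq_bigr => k _ do
      rewrite mulrCA [_%:R * _](_ : _ = pseries_diffs (exp_coef A k j) l)// exp_coef_diffs.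
    rewrite expr2; under [RHS]eq_bigr do rewrite mxE mulr_suml.
    rewrite exchange_big/=; apply: eq_bigr => k _.
    by rewrite mulr_sumr; apply: eq_bigr => k' _; rewrite mulrA.
  exact: (cvgD (fun a b => (A ^+ 2) a b)).
- by rewrite [ltRHS]ger0_norm ?ltrDl// addr_ge0.
Qed.

Lemma expm0 : expm (0 : 'M[R]_n) = 1.
Proof.
apply/matrixP => i j; rewrite -(scale0r (0 : 'M[R]_n)) expmZE.
apply: cvg_lim => //; rewrite -(cvg_shiftn 1)/=.
have -> : (fun l => pseries (exp_coef (0 : 'M[R]_n) i j) 0 (l + 1)%N) = cst ((1 : 'M[R]_n) i j).
  apply/funext => l; rewrite /pseries/series/= addn1 big_nat_recl//= expr0 mulr1.
  rewrite big1 ?addr0 ?/exp_coef ?fact0 ?divr1 ?expr0// => k _.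
  by rewrite [0 ^+ _ in X in _ * X]expr0n mulr0.
exact: cvg_cst.
Qed.

Lemma commute_exprmx A C l : C *m A = A *m C -> C *m A ^+ l = A ^+ l *m C.
Proof.
move=> CA; elim: l => [|l IHl]; first by rewrite !expr0 mulmx1 mul1mx.
rewrite !exprS; change (C *m (A *m A ^+ l) = A *m A ^+ l *m C).
by rewrite mulmxA CA -mulmxA IHl mulmxA.
Qed.

(** Since C A^l = A^l C for all l, both sides are limits of power series in s with the same
    coefficients. *)
Lemma expm_comm A C s : C *m A = A *m C ->
  C *m expm (s *: A) = expm (s *: A) *m C.
Proof.
move=> CA; apply/matrixP => i j; rewrite !mxE.
have L : pseries (fun l => \sum_k C i k * exp_coef A k j l) s @ \oo -->
    \sum_k C i k * expm (s *: A) k j.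
  under [X in _ --> X]eq_bigr do rewrite expmZE.
  by apply: cvg_sum_pseries => k; exact: is_cvg_pseries_exp_coef.
have M : pseries (fun l => \sum_k C k j * exp_coef A i k l) s @ \oo -->
    \sum_k expm (s *: A) i k * C k j.
  under [X in _ --> X]eq_bigr do rewrite expmZE mulrC.
  by apply: cvg_sum_pseries => k; exact: is_cvg_pseries_exp_coef.
suff LM : (fun l => \sum_k C i k * exp_coef A k j l) =
          (fun l => \sum_k C k j * exp_coef A i k l).
  by rewrite LM in L; apply: (cvg_unique _ L M).
apply/funext => l; have /matrixP/(_ i j) := commute_exprmx l CA.
rewrite !mxE /exp_coef => /(congr1 (fun z => z / l`!%:R)).
rewrite !mulr_suml; under eq_bigr do rewrite -mulrA.
by move=> ->; apply: eq_bigr => k _; rewrite mulrA [C k j * _]mulrC.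
Qed.

End Exponential.

(** * Entrywise derivatives, the semigroup law and uniqueness for h' = A h *)

Section MatrixDerivative.
Context (R : realType).

(** Entrywise, so that only scalar derivatives occur and no norm on matrices is involved. *)
Definition mx_derive p q (F : R -> 'M[R]_(p, q)) (x : R) (D : 'M[R]_(p, q)) :=
  forall i j, is_derive x 1 (fun s => F s i j) (D i j).

Lemma mx_derive_cst p q (C : 'M[R]_(p, q)) x : mx_derive (fun=> C) x 0.
Proof. by move=> i j; rewrite mxE; exact: is_derive_cst. Qed.

Lemma mx_deriveM p q r (F : R -> 'M[R]_(p, q)) (G : R -> 'M[R]_(q, r)) x D E :
  mx_derive F x D -> mx_derive G x E ->
  mx_derive (fun s => F s *m G s) x (D *m G x + F x *m E).
Proof.
move=> dF dG i j; rewrite !mxE -big_split/=.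
rewrite (_ : (fun s => _) = \sum_k (fun s => F s i k) * (fun s => G s k j)); last first.
  by apply/funext => s; rewrite mxE fct_sumE.
apply: (@is_derive_sum _ _ _ _ (fun k => (fun s => F s i k) * (fun s => G s k j)) _ _
  (fun k => D i k * G x k j + F x i k * E k j)) => k.
apply: is_derive_eq; first by apply: is_deriveM; [exact: dF|exact: dG].
by rewrite addrC /GRing.scale/= mulrC.
Qed.

Lemma mx_deriveMl p q r (C : 'M[R]_(p, q)) (G : R -> 'M[R]_(q, r)) x E :
  mx_derive G x E -> mx_derive (fun s => C *m G s) x (C *m E).
Proof.
by move=> /(mx_deriveM (mx_derive_cst C x)); rewrite mul0mx add0r.
Qed.

Lemma mx_deriveMr p q r (F : R -> 'M[R]_(p, q)) (C : 'M[R]_(q, r)) x D :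
  mx_derive F x D -> mx_derive (fun s => F s *m C) x (D *m C).
Proof.
by move=> /mx_deriveM/(_ (mx_derive_cst C x)); rewrite mulmx0 addr0.
Qed.

Lemma mx_derive_expm n (A : 'M[R]_n) c b x :
  mx_derive (fun s => expm ((c * s + b) *: A)) x
    (c *: (A *m expm ((c * x + b) *: A))).
Proof.
move=> i j; rewrite [in X in is_derive _ _ _ X]mxE mulrC.
apply: (@is_derive1_comp R (fun s => expm (s *: A) i j) (fun s => c * s + b)).
  exact: is_derive_expm.
apply: (@is_derive_eq _ _ _ (c \*: id + cst b)).
by rewrite /GRing.scale/= mulr1 addr0.
Qed.

Lemma mx_derive_expmB n (A : 'M[R]_n) b x :
  mx_derive (fun s => expm ((s - b) *: A)) x (A *m expm ((x - b) *: A)).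
Proof.
have := mx_derive_expm A 1 (- b) x; rewrite scale1r mul1r.
by rewrite (_ : (fun s => expm (_ *: A)) = (fun s => expm ((s - b) *: A)))//;
  apply/funext => s; rewrite mul1r.
Qed.

Lemma mx_derive_expmBr n (A : 'M[R]_n) b x :
  mx_derive (fun s => expm ((b - s) *: A)) x (- (A *m expm ((b - x) *: A))).
Proof.
have := mx_derive_expm A (-1) b x; rewrite scaleN1r mulN1r (addrC (- x)).
by rewrite (_ : (fun s => expm (_ *: A)) = (fun s => expm ((b - s) *: A)))//;
  apply/funext => s; rewrite mulN1r addrC.
Qed.

Lemma mx_derive0_cst p q (F : R -> 'M[R]_(p, q)) x y :
  (forall s, mx_derive F s 0) -> F x = F y.
Proof.
move=> dF; apply/matrixP => i j.
by apply: (is_derive_0_is_cst (f := fun s => F s i j)) => s; have := dF s i j; rewrite mxE.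
Qed.

(** The product e^{xA} e^{(s+r-x)A} has zero derivative in x, and its values at x = 0 and x = s are
    the two sides. *)
Lemma expm_scaleD n (A : 'M[R]_n) s r :
  expm ((s + r) *: A) = expm (s *: A) *m expm (r *: A).
Proof.
pose G x := expm ((x - 0) *: A) *m expm ((s + r - x) *: A).
have : G 0 = G s.
  apply: mx_derive0_cst => x.
  have := mx_deriveM (mx_derive_expmB A 0 x) (mx_derive_expmBr A (s + r) x).
  by rewrite mulmxN mulmxA expm_comm// subrr.
by rewrite /G !subr0 scale0r expm0 mul1mx addrAC subrr add0r.
Qed.

(** The product e^{-xA} h(x) has zero derivative, hence stays equal to 1, and e^{sA} inverts
    e^{-sA}. *)
Lemma expm_unique n (A : 'M[R]_n) (h : R -> 'M[R]_n) s :
  (forall x, mx_derive h x (A *m h x)) -> h 0 = 1 -> h s = expm (s *: A).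
Proof.
move=> dh h0.
pose G x := expm ((0 - x) *: A) *m h x.
have : G 0 = G s.
  apply: mx_derive0_cst => x.
  have := mx_deriveM (mx_derive_expmBr A 0 x) (dh x).
  by rewrite mulmxA -expm_comm// mulNmx addNr.
rewrite /G subrr h0 scale0r expm0 mul1mx sub0r => /esym e.
have e1 : expm (s *: A) *m expm ((- s) *: A) = 1%:M.
  by rewrite -expm_scaleD subrr scale0r expm0.
by rewrite -[LHS]mul1mx -e1 -mulmxA e mulmx1.
Qed.

End MatrixDerivative.

(** * Nonnegativity, substochasticity and decay of e^{sB} *)

Section SubGenerator.
Context (R : realType).

Lemma expmx_ge0 n (A : 'M[R]_n) l : (forall i j, 0 <= A i j) ->
  forall i j, 0 <= (A ^+ l) i j.
Proof.
move=> A0; elim: l => [|l IHl] i j; first by rewrite expr0 mxE ler0n.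
by rewrite exprS mxE; apply: sumr_ge0 => k _; exact: mulr_ge0.
Qed.

Lemma expm_nonneg_ge0 n (A : 'M[R]_n) s : (forall i j, 0 <= A i j) -> 0 <= s ->
  forall i j, 0 <= expm (s *: A) i j.
Proof.
move=> A0 s0 i j; rewrite expmZE.
apply: limr_ge; first exact: is_cvg_pseries_exp_coef.
apply: nearW => N; apply: sumr_ge0 => l _.
by rewrite mulr_ge0 ?exprn_ge0// divr_ge0 ?ler0n//; exact: expmx_ge0.
Qed.

(* Shifting by a large multiple c of the identity makes the matrix nonnegative,
   and e^{sA} = e^{-cs} e^{s(A + cI)}. *)
Lemma expm_ge0 n (A : 'M[R]_n) s :
  (forall i j, i != j -> 0 <= A i j) -> 0 <= s ->
  forall i j, 0 <= expm (s *: A) i j.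
Proof.
move=> Aoff s0 i j.
pose c := \sum_i `|A i i|.
have Ac0 i' j' : 0 <= (A + c%:M) i' j'.
  rewrite !mxE; have [<-|ij] := eqVneq i' j'; last by rewrite mulr0n addr0 Aoff.
  rewrite mulr1n -lerBlDl sub0r /c (bigD1 i')//= (le_trans (ler_norm _))//.
  by rewrite normrN lerDl; apply: sumr_ge0.
pose h x := expR (- c * x) *: expm (x *: (A + c%:M)).
(* Uniqueness for h' = A h with h(0) = 1 stands in for the law of exponentials of commuting sums. *)
have hE : h s = expm (s *: A).
  apply: expm_unique => [x i' j'|]; last by rewrite /h mulr0 expR0 scale0r expm0 scale1r.
  rewrite (_ : (fun s : R => h s i' j') =
    (fun x => expR (- c * x)) * (fun x => expm (x *: (A + c%:M)) i' j')); last first.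
    by apply/funext => y; rewrite /h mxE.
  have d1 : is_derive x 1 (fun x => expR (- c * x)) (expR (- c * x) * (- c)).
    apply: (@is_derive1_comp _ expR (fun x => - c * x)).
    apply: (@is_derive_eq _ _ _ ((- c) \*: id)).
    by rewrite /GRing.scale/= mulr1.
  apply: is_derive_eq; first exact: (is_deriveM d1 (is_derive_expm _ _ _ _)).
  rewrite /h -scalemxAr mulmxDl mul_scalar_mx; move: (expm _) => M.
  by rewrite [in RHS]mxE [X in _ *: X + _]mxE [X in _ *: (_ + X)]mxE /GRing.scale/=; ring.
rewrite -hE mxE mulr_ge0 ?expR_ge0//; exact: expm_nonneg_ge0.
Qed.

(** Every power of A inherits the zero block. C is a bare predicate because the lemma serves both B
    on E and [absorbing_Q B] on the whole state space. *)
Lemma expm_closed0 n (A : 'M[R]_n) (C : {pred 'I_n}) s :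
  (forall i j, i \in C -> j \notin C -> A i j = 0) ->
  forall i j, i \in C -> j \notin C -> expm (s *: A) i j = 0.
Proof.
move=> AC i j iC jC; rewrite expmZE.
have AC' l : (A ^+ l) i j = 0.
  elim: l i iC => [|l IHl] i iC.
    by rewrite expr0 mxE (_ : (i == j) = false)//; apply: contraNF jC => /eqP <-.
  rewrite exprS mxE big1// => k _.
  by have [kC|kC] := boolP (k \in C); [rewrite IHl ?mulr0|rewrite AC ?mul0r].
apply: cvg_lim => //; rewrite (_ : pseries _ _ = cst 0); first exact: cvg_cst.
by apply/funext => N; rewrite /pseries/series/= big1// => l _; rewrite /exp_coef AC' !mul0r.
Qed.

Lemma expm_absorbing_Q n (B : 'M[R]_n) s (i j : 'I_n) :
  expm (s *: absorbing_Q B) (transient i) (transient j) = expm (s *: B) i j.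
Proof.
rewrite !expmZE; congr (limn (pseries _ _)); apply/funext => l; rewrite /exp_coef; congr (_ / _).
(* The lower left block stays 0, which is why the upper left one is exactly B^l; the second block
   column is left unspecified. *)
have [b [c ->]] : exists b c, absorbing_Q B ^+ l = block_mx (B ^+ l) b 0 c.
  elim: l => [|l [b [c IHl]]].
    by exists 0, 1%:M; rewrite !expr0; exact: scalar_mx_block.
  exists (B *m b - B *m ones R n *m c), 0; rewrite !exprS IHl.
  transitivity (absorbing_Q B *m block_mx (B ^+ l) b 0 c); first by [].
  by rewrite /absorbing_Q mulmx_block !mulmx0 !mul0mx !addr0 mulNmx.
by rewrite /transient block_mxEul.
Qed.

Lemma derive_le0_nincr (f df : R -> R) : (forall x : R, is_derive x 1 f (df x)) ->
  (forall x, 0 <= x -> df x <= 0) -> forall x y, 0 <= x -> x <= y -> f y <= f x.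
Proof.
move=> fdf df0 x y x0 xy.
apply: (@ler0_derive1_nincry _ _ 0) => //.
- by move=> z; rewrite in_itv/= andbT => z0; rewrite derive1E (@derive_val _ _ _ _ _ _ _ (fdf z)) df0// ltW.
- by apply: derivable_within_continuous => z _.
Qed.

Section Decay.
Context n (B : 'M[R]_n).
Hypotheses (Boff : forall i j, i != j -> 0 <= B i j)
  (Brow : forall i, (B *m ones R n) i ord0 <= 0).

(** The phase-type survival function: the probability that the chain started at i has not been
    absorbed by time x. *)
Definition survival (x : R) i := (expm (x *: B) *m ones R n) i ord0.

Lemma survivalE x i : survival x i = \sum_j expm (x *: B) i j.
Proof. by rewrite /survival mxE; apply: eq_bigr => j _; rewrite [ones _ _ _ _]mxE mulr1. Qed.

(** B 1, nonpositive by [Brow], is put behind the nonnegative e^{xB}, so that the sign of the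
    derivative can be read off. *)
Lemma survival_derive (x : R) i :
  is_derive x 1 (survival ^~ i) ((expm (x *: B) *m (B *m ones R n)) i ord0).
Proof.
have := mx_deriveMr (ones R n) (mx_derive_expmB B 0 x) i ord0.
rewrite subr0 expm_comm// mulmxA.
rewrite (_ : (fun s => _) = (survival ^~ i))//; apply/funext => y.
by rewrite /survival subr0.
Qed.

Lemma survival_derive_le0 x i : 0 <= x ->
  (expm (x *: B) *m (B *m ones R n)) i ord0 <= 0.
Proof.
move=> x0; rewrite mxE; apply: sumr_le0 => k _.
by rewrite mulr_ge0_le0//; exact: expm_ge0.
Qed.

Lemma expm_entry_le_survival x i j : 0 <= x -> expm (x *: B) i j <= survival x i.
Proof.
move=> x0; rewrite survivalE (bigD1 j)//= lerDl.
by apply: sumr_ge0 => k _; exact: expm_ge0.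
Qed.

Lemma survival_le1 x i : 0 <= x -> survival x i <= 1.
Proof.
move=> x0.
have -> : 1 = survival 0 i.
  by rewrite /survival scale0r expm0 mul1mx mxE.
apply: (derive_le0_nincr (survival_derive ^~ i)) => // y y0.
exact: survival_derive_le0.
Qed.

(* With f the survival function, (e^{xB} B^-1 1)' = f, so that f nonincreasing
   gives x f(x) <= e^{xB} B^-1 1 - B^-1 1, which is bounded. *)
Lemma survival_decay x i : B \in unitmx -> 0 <= x ->
  x * survival x i <= 2 * \sum_j `|(invmx B *m ones R n) j ord0|.
Proof.
move=> uB x0; set u := invmx B *m ones R n.
pose g y := y * survival y i - (expm (y *: B) *m u) i ord0.
(* As B u = 1, the derivative of e^{yB} u is the survival function, which cancels one term of the
   product rule; y times the derivative of [survival] is left. *)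
have dg (y : R) : is_derive y 1 g (y * (expm (y *: B) *m (B *m ones R n)) i ord0).
  have d1 := is_deriveM (is_derive_id y 1) (survival_derive y i).
  have d2 := mx_deriveMr u (mx_derive_expmB B 0 y) i ord0.
  have -> : g = id * (survival ^~ i) - (fun z => (expm ((z - 0) *: B) *m u) i ord0).
    apply/funext => z.
    by change (g z = z * survival z i - (expm ((z - 0) *: B) *m u) i ord0); rewrite subr0.
  apply: is_derive_eq.
  rewrite subr0 expm_comm// -mulmxA mulKVmx// /GRing.scale/= mulr1.
  by rewrite -/(survival _ _) addrK.
have := derive_le0_nincr dg _ (lexx 0) x0.
rewrite /g mul0r sub0r scale0r expm0 mul1mx lerBlDr => /(_ _)/le_trans; apply.
  by move=> y y0; rewrite mulr_ge0_le0//; exact: survival_derive_le0.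
(* Origin of the factor 2: the entries of e^{xB} lie in [0, 1], so both -u_i and (e^{xB} u)_i are at
   most the sum of the |u_j|. *)
rewrite mulr_natl mulr2n lerD//.
  rewrite (bigD1 i)//= (le_trans (ler_norm _))// normrN lerDl.
  by apply: sumr_ge0.
rewrite mxE; apply: ler_sum => j _.
rewrite (le_trans (ler_norm _))// normrM ger0_norm ?expm_ge0// ler_piMl//.
exact: le_trans (expm_entry_le_survival _ _ x0) (survival_le1 _ x0).
Qed.

(** An entry lies between 0 and its row sum, which [survival_decay] bounds by K / x. *)
Lemma expm_cvg0 i j : B \in unitmx -> expm (x *: B) i j @[x --> +oo] --> 0.
Proof.
move=> uB; set K := 2 * \sum_j `|(invmx B *m ones R n) j ord0|.
have K0 : 0 <= K by rewrite mulr_ge0// sumr_ge0.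
apply/cvgrPdist_lt => e e0; near=> x.
have x0 : 0 < x by near: x; exact: nbhs_pinfty_gt.
rewrite sub0r normrN ger0_norm ?expm_ge0// ?(ltW x0)//.
apply: le_lt_trans (expm_entry_le_survival _ _ (ltW x0)) _.
rewrite -(ltr_pM2l x0) (le_lt_trans (survival_decay _ uB (ltW x0)))//.
rewrite -ltr_pdivrMr//; near: x; apply: nbhs_pinfty_gt; exact: num_real.
Unshelve. all: by end_near. Qed.

End Decay.
End SubGenerator.

(** * Signs and measurability of the kernels *)

Section Signs.
Context (R : realType) (n : nat).
Implicit Types (B : 'M[R]_n) (Gam : {set state n}).

Lemma absorbing_QE B i j : absorbing_Q B (transient i) (transient j) = B i j.
Proof. exact: block_mxEul. Qed.

Lemma intensity_offdiag_ge0 B : intensity_matrix (absorbing_Q B) ->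
  forall i j, i != j -> 0 <= B i j.
Proof.
by move=> [off _] i j ij; rewrite -absorbing_QE off// (inj_eq (@lshift_inj _ _)).
Qed.

Lemma intensity_rowsum_le0 B : intensity_matrix (absorbing_Q B) ->
  forall i, (B *m ones R n) i ord0 <= 0.
Proof.
move=> [off _] i; have := off (transient i) (Delta n).
rewrite /absorbing_Q /transient /Delta block_mxEur eq_lrshift => /(_ isT).
by rewrite mxE oppr_ge0.
Qed.

Lemma Hmx_mulE Gam p (M : 'M[R]_(n, p)) (i : 'I_n) j :
  (Hmx R Gam *m M) i j = (transient i \notin Gam)%:R * M i j.
Proof. by rewrite mul_diag_mx mxE [X in X * _]mxE. Qed.

Lemma Hmx_onesE Gam (i : 'I_n) : (Hmx R Gam *m ones R n) i ord0 = (transient i \notin Gam)%:R.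
Proof. by rewrite Hmx_mulE mxE mulr1. Qed.

Lemma Hmx_comm Gam1 Gam2 : Hmx R Gam1 *m Hmx R Gam2 = Hmx R Gam2 *m Hmx R Gam1.
Proof. exact: diag_mxC. Qed.

Lemma commutator_HmxE B Gam i j : commutator B (Hmx R Gam) i j =
  B i j * ((transient j \notin Gam)%:R - (transient i \notin Gam)%:R).
Proof.
by rewrite /commutator mul_mx_diag mul_diag_mx !mxE mulrBr [_ * B i j]mulrC.
Qed.

Definition closed_for B Gam := forall i j,
  transient i \in Gam -> transient j \notin Gam -> B i j = 0.

(** With h the indicator of the complement of [Gam], the entry is B_ij (h_j - h_i), so only jumps
    across the boundary count. Closedness excludes those leaving [Gam], and those entering it carry
    -B_ij. *)
Lemma commutator_Hmx_le0 B Gam i j : closed_for B Gam ->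
  (forall i j, i != j -> 0 <= B i j) -> commutator B (Hmx R Gam) i j <= 0.
Proof.
move=> BG Boff; rewrite commutator_HmxE.
have [->|ij] := eqVneq i j; first by rewrite subrr mulr0.
have [iG|iG] := boolP (transient i \in Gam); have [jG|jG] := boolP (transient j \in Gam) => //=.
- by rewrite subr0 mulr0.
- by rewrite BG// mul0r.
- by rewrite sub0r mulrN1 oppr_le0 Boff.
- by rewrite subrr mulr0.
Qed.

Lemma commutator_Hmx_eq0 B Gam i j : closed_for B Gam ->
  (transient i \in Gam) || (transient j \notin Gam) -> commutator B (Hmx R Gam) i j = 0.
Proof.
move=> BG; rewrite commutator_HmxE.
have [iG|iG] := boolP (transient i \in Gam); have [jG|jG] := boolP (transient j \in Gam) => //= _.
- by rewrite subr0 mulr0.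
- by rewrite BG// mul0r.
- by rewrite subrr mulr0.
Qed.

Section TwoSets.
Context B (Gam1 Gam2 : {set state n}).
Hypotheses (hQ : intensity_matrix (absorbing_Q B))
  (c1 : closed_for B Gam1) (c2 : closed_for B Gam2)
  (dis : forall i : 'I_n, transient i \in Gam1 -> transient i \notin Gam2).

(* A jump into Gam2 contributes the rate of a later exit to Gam1, and inside Gam2
   the only way to reach Gam1 is through Delta. *)
Lemma kernel_ge0 s i : 0 <= s ->
  0 <= (commutator B (Hmx R Gam2) *m (expm (s *: B) *m
         (B *m (Hmx R Gam1 *m ones R n)))) i ord0.
Proof.
have Boff := intensity_offdiag_ge0 hQ.
move=> s0; rewrite mxE; apply: sumr_ge0 => j _.
have [iG|iG] := boolP (transient i \in Gam2); first by rewrite commutator_Hmx_eq0 ?iG ?mul0r.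
have [jG|jG] := boolP (transient j \in Gam2); last by rewrite commutator_Hmx_eq0 ?jG ?orbT ?mul0r.
(* What remains is a jump from i outside [Gam2] to j inside. Its commutator entry is nonpositive, so
   the other factor has to be nonpositive as well. *)
apply: mulr_le0; first exact: commutator_Hmx_le0.
rewrite mxE; apply: sumr_le0 => l _.
have [lG|lG] := boolP (transient l \in Gam2); last first.
  rewrite (@expm_closed0 _ _ B [pred i | transient i \in Gam2]) ?mul0r//.
rewrite mulr_ge0_le0//; first exact: expm_ge0.
(* From l in [Gam2], B leads only to transient states of [Gam2], which are outside [Gam1]; row l of
   B thus does not see the projection, and its sum is minus the rate of absorption. *)
suff -> : (B *m (Hmx R Gam1 *m ones R n)) l ord0 = (B *m ones R n) l ord0.
  exact: intensity_rowsum_le0.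
rewrite !mxE; apply: eq_bigr => r _.
rewrite Hmx_onesE [ones _ _ _ _]mxE.
by case: (boolP (transient r \in Gam1)) => // /dis rG; rewrite c2 ?mul0r.
Qed.

(** The kernel is 0 at i in [Gam1] or [Gam2] and -(B 1)_i elsewhere: the rate of a direct jump to
    Delta, the only way to enter both sets at once. *)
Lemma diagonal_kernel_ge0 i :
  0 <= ((commutator B (Hmx R Gam2) *m Hmx R Gam1 + commutator B (Hmx R Gam1) *m Hmx R Gam2
         - B *m Hmx R Gam2 *m Hmx R Gam1) *m ones R n) i ord0.
Proof.
have Boff := intensity_offdiag_ge0 hQ.
rewrite mulmxDl mulNmx mulmxDl -!mulmxA.
have -> : forall a b c : 'cV[R]_n, (a + b - c) i ord0 = a i ord0 + b i ord0 - c i ord0.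
  by move=> a b c; rewrite !mxE.
have E2 : (B *m (Hmx R Gam2 *m (Hmx R Gam1 *m ones R n))) i ord0 =
    \sum_j B i j * ((transient j \notin Gam2)%:R * (transient j \notin Gam1)%:R).
  by rewrite mxE; apply: eq_bigr => j _; rewrite Hmx_mulE Hmx_onesE.
rewrite E2.
have E3 Ga Gb : (commutator B (Hmx R Ga) *m (Hmx R Gb *m ones R n)) i ord0 =
    \sum_j commutator B (Hmx R Ga) i j * (transient j \notin Gb)%:R.
  by rewrite mxE; apply: eq_bigr => j _; rewrite Hmx_onesE.
rewrite !E3 -big_split/= -sumrB/=.
have [i1|i1] := boolP (transient i \in Gam1).
  rewrite big1// => j _; rewrite !commutator_HmxE i1/= (dis i1)/=.
  have [j1|j1] := boolP (transient j \in Gam1); last by rewrite c1 ?mul0r ?subr0 ?addr0.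
  by rewrite (dis j1)/= !(mulr0, subrr, addr0, mul0r).
have [i2|i2] := boolP (transient i \in Gam2).
  rewrite big1// => j _; rewrite !commutator_HmxE i1 i2/=.
  have [j2|j2] := boolP (transient j \in Gam2); last by rewrite c2 ?mul0r ?subr0 ?addr0.
  by rewrite !(mulr0, subrr, addr0, mul0r, subr0).
rewrite (_ : \sum_j _ = - (B *m ones R n) i ord0).
  by rewrite oppr_ge0 intensity_rowsum_le0.
rewrite mxE -sumrN; apply: eq_bigr => j _; rewrite !commutator_HmxE [ones _ _ _ _]mxE i1 i2/=.
have [j1|j1] := boolP (transient j \in Gam1).
  by rewrite (dis j1)/=; ring.
by case: (transient j \in Gam2) => /=; ring.
Qed.

End TwoSets.
End Signs.

(** * Entrywise measurability of matrix-valued functions *)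

Section MatrixMeasurability.
Context d (T : measurableType d) (R : realType).

Definition mx_measurable p q (F : T -> 'M[R]_(p, q)) :=
  forall i j, measurable_fun setT (fun w => F w i j).

Lemma mx_measurable_cst p q (C : 'M[R]_(p, q)) : mx_measurable (fun=> C).
Proof. by move=> i j; exact: measurable_cst. Qed.

Lemma mx_measurableM p q r (F : T -> 'M[R]_(p, q)) (G : T -> 'M[R]_(q, r)) :
  mx_measurable F -> mx_measurable G -> mx_measurable (fun w => F w *m G w).
Proof.
move=> mF mG i j.
under eq_fun do rewrite mxE.
by apply: measurable_sum => k; apply: measurable_funM; [exact: mF|exact: mG].
Qed.

Lemma continuous_expm n (A : 'M[R]_n) i j : continuous (fun s : R => expm (s *: A) i j).
Proof.
move=> x; apply/differentiable_continuous/derivable1_diffP.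
by have [] := is_derive_expm A x i j.
Qed.

Lemma mx_measurable_expm n (A : 'M[R]_n) (g : T -> R) :
  measurable_fun setT g -> mx_measurable (fun w => expm (g w *: A)).
Proof.
move=> mg i j.
rewrite (_ : (fun w => _) = (fun s : R => expm (s *: A) i j) \o g)//.
apply: measurableT_comp => //. apply: continuous_measurable_fun. exact: continuous_expm.
Qed.

End MatrixMeasurability.

(** * Integrals of exponential forms *)

Section ExponentialIntegrals.
Context (R : realType) (n m : nat) (B : 'I_m -> 'M[R]_n).
Implicit Types (a b c t : R).

Lemma is_derive_sum_mx (F : 'I_m -> R -> 'M[R]_1) (x : R) (D : 'I_m -> 'M[R]_1) :
  (forall k, mx_derive (F k) x (D k)) ->
  is_derive x 1 (fun s => \sum_k F k s ord0 ord0) (\sum_k D k ord0 ord0).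
Proof.
move=> dF; rewrite (_ : (fun s => _) = \sum_k (fun s => F k s ord0 ord0)); last first.
  by apply/funext => s; rewrite fct_sumE.
by apply: (@is_derive_sum _ _ _ _ (fun k s => F k s ord0 ord0) _ _
  (fun k => D k ord0 ord0)) => k; exact: dF.
Qed.

Lemma is_derive_continuous (f : R -> R) (df : R -> R) :
  (forall x : R, is_derive x 1 f (df x)) -> continuous f.
Proof.
by move=> fdf x; apply/differentiable_continuous/derivable1_diffP; have [] := fdf x.
Qed.

Lemma cvg0_sum_expm (v : 'I_m -> 'rV[R]_n) (c : 'I_m -> 'cV[R]_n) b :
  (forall k, B k \in unitmx) -> (forall k, intensity_matrix (absorbing_Q (B k))) ->
  (\sum_k (v k *m expm ((x - b) *: B k) *m c k) ord0 ord0) @[x --> +oo] --> (0 : R).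
Proof.
move=> uB hQ; rewrite -[X in _ --> X](@big1_eq R 0 +%R _ (index_enum 'I_m) xpredT).
apply: cvg_big => [|k _]; first exact: add_continuous.
rewrite [X in X @ _ --> _](_ : _ = fun x =>
    \sum_j \sum_i v k ord0 i * expm ((x - b) *: B k) i j * c k j ord0); last first.
  apply/funext => x; rewrite mxE; apply: eq_bigr => j _.
  by rewrite mxE mulr_suml.
rewrite -[X in _ --> X](@big1_eq R 0 +%R _ (index_enum 'I_n) xpredT).
apply: cvg_big => [|j _]; first exact: add_continuous.
rewrite -[X in _ --> X](@big1_eq R 0 +%R _ (index_enum 'I_n) xpredT).
apply: cvg_big => [|i _]; first exact: add_continuous.
rewrite -[X in _ --> X](mul0r (c k j ord0)).
apply: cvgMr_tmp; rewrite -[X in _ --> X](mulr0 (v k ord0 i)); apply: cvgMl_tmp.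
have := @expm_cvg0 _ _ (B k) (intensity_offdiag_ge0 (hQ k)) (intensity_rowsum_le0 (hQ k)) i j (uB k).
apply: cvg_comp; apply/cvgryPge => A; near=> x.
by rewrite lerBrDr; near: x; apply: nbhs_pinfty_ge; exact: num_real.
Unshelve. all: by end_near. Qed.

(** An antiderivative of v e^{(x-b)B} c is v e^{(x-b)B} B^-1 c, which vanishes at +oo. Nonnegativity
    of the integrand is what carries the fundamental theorem over to a half-line. *)
Lemma integral_expm_tail (v : 'I_m -> 'rV[R]_n) (c : 'I_m -> 'cV[R]_n) a b :
  (forall k, B k \in unitmx) -> (forall k, intensity_matrix (absorbing_Q (B k))) ->
  (forall x, a <= x -> 0 <= \sum_k (v k *m expm ((x - b) *: B k) *m c k) ord0 ord0) ->
  (\int[lebesgue_measure]_(x in `]a, +oo[)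
     (\sum_k (v k *m expm ((x - b) *: B k) *m c k) ord0 ord0)%:E =
   (- \sum_k (v k *m expm ((a - b) *: B k) *m (invmx (B k) *m c k)) ord0 ord0)%:E)%E.
Proof.
move=> uB hQ f0.
(* One family holds both the integrand, at u = c, and its antiderivative, at u = B^-1 c. *)
pose G (u : 'I_m -> 'cV[R]_n) x := \sum_k (v k *m expm ((x - b) *: B k) *m u k) ord0 ord0.
have dG u (x : R) : is_derive x 1 (G u) (G (fun k => B k *m u k) x).
  apply: is_derive_sum_mx => k.
  have := mx_deriveMr (u k) (mx_deriveMl (v k) (mx_derive_expmB (B k) b x)).
  by rewrite expm_comm// !mulmxA.
have cG u : continuous (G u) by exact: is_derive_continuous (dG u).
have GE : (G (fun k => B k *m (invmx (B k) *m c k))) = G c.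
  by apply/funext => x; apply: eq_bigr => k _; rewrite mulKVmx.
rewrite integral_itv_obnd_cbnd; last first.
  apply/measurable_EFinP/measurable_funTS; apply: continuous_measurable_fun.
  exact: (cG c).
rewrite (@ge0_continuous_FTC2y _ (G c) (G (fun k => invmx (B k) *m c k)) a 0) ?sub0e//.
- by apply: continuous_subspaceT; exact: cG.
- exact: cvg0_sum_expm.
- by apply/cvg_at_right_filter/cG.
- move=> x _; rewrite derive1E (@derive_val _ _ _ _ _ _ _ (dG _ x)).
  by rewrite GE.
Qed.

Lemma integral_expm_commutator (H : 'M[R]_n) (v : 'I_m -> 'rV[R]_n) (w : 'I_m -> 'cV[R]_n) b c t :
  b <= c ->
  (\int[lebesgue_measure]_(y in `]b, c])
     (- \sum_k (v k *m expm ((y - t) *: B k) *m commutator (B k) H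
                *m expm ((c - y) *: B k) *m w k) ord0 ord0)%:E =
   (\sum_k (v k *m expm ((b - t) *: B k) *m H *m expm ((c - b) *: B k) *m w k) ord0 ord0 -
    \sum_k (v k *m expm ((c - t) *: B k) *m H *m w k) ord0 ord0)%:E)%E.
Proof.
(* The fundamental theorem is applied for b < c; at b = c the interval is empty and the boundary
   terms coincide. *)
rewrite le_eqVlt => /predU1P[->|bc].
  rewrite set_itv_ge ?bnd_simp ?ltxx// integral_set0 subrr.
  by rewrite -sumrB big1// => k _; rewrite scale0r expm0 mulmx1 subrr.
pose G (K : 'I_m -> 'M[R]_n) y := \sum_k (v k *m expm ((y - t) *: B k) *m K k
                *m expm ((c - y) *: B k) *m w k) ord0 ord0.
have dG K (y : R) : is_derive y 1 (G K) (G (fun k => commutator (B k) (K k)) y).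
  apply: is_derive_sum_mx => k.
  have := mx_deriveMr (w k) (mx_deriveM
    (mx_deriveMr (K k) (mx_deriveMl (v k) (mx_derive_expmB (B k) t y)))
    (mx_derive_expmBr (B k) c y)).
  rewrite (expm_comm (y - t))// /commutator mulmxN.
  suff -> : v k *m (expm ((y - t) *: B k) *m B k) *m K k *m expm ((c - y) *: B k) -
    v k *m expm ((y - t) *: B k) *m K k *m (B k *m expm ((c - y) *: B k)) =
    v k *m expm ((y - t) *: B k) *m (B k *m K k - K k *m B k) *m expm ((c - y) *: B k) by [].
  by rewrite mulmxBr mulmxBl !mulmxA.
have cG K : continuous (G K) by exact: is_derive_continuous (dG K).
pose f y := - G (fun k => commutator (B k) H) y; pose F y := - G (fun=> H) y.
have cf : continuous f by move=> y; apply: cvgN; exact: cG.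
have cF : continuous F by move=> y; apply: cvgN; exact: cG.
have dF (y : R) : is_derive y 1 F (f y) by exact: is_deriveN.
rewrite integral_itv_obnd_cbnd; last first.
  by apply/measurable_EFinP/measurable_funTS; exact: continuous_measurable_fun.
rewrite (@continuous_FTC2 _ f F b c bc).
- rewrite /F /G -EFinB; congr (_%:E); rewrite opprK addrC; congr (_ - _).
  by apply: eq_bigr => k _; rewrite subrr scale0r expm0 mulmx1.
- exact: continuous_subspaceT.
- split; [by move=> y _; have [] := dF y|exact/cvg_at_right_filter/cF|exact/cvg_at_left_filter/cF].
- by move=> y _; rewrite derive1E (@derive_val _ _ _ _ _ _ _ (dF y)).
Qed.

End ExponentialIntegrals.

(** * Iterated integrals on either side of the diagonal *)

Section Tonelli.
Context (R : realType).
Local Notation mR := (measurableTypeR R).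
Local Notation lam := (@lebesgue_measure R).
Local Open Scope ereal_scope.

Lemma measurable_below_diag (a b : R) :
  measurable [set z : mR * mR | (a < z.1 /\ b < z.2) /\ z.2 < z.1]%R.
Proof.
rewrite (_ : mkset _ = setT `&` [set z : mR * mR | ((a < z.1) && (b < z.2)) && (z.2 < z.1)]%R).
  have mb : measurable_fun setT
      (fun z : mR * mR => ((a < z.1) && (b < z.2)) && (z.2 < z.1))%R.
    by do !(apply: measurable_and || apply: measurable_fun_ltr).
  by have := mb measurableT [set true] I; rewrite setTI.
by rewrite setTI; apply/seteqP; split => z/=; [case=> -[-> ->] ->|move=> /andP[/andP[-> ->] ->]].
Qed.

(** The larger coordinate is integrated first, because the later time enters [density1] through a
    single exponential; x > a and x > y combine into the lower limit max(a, y). *)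
Lemma integral_below_diag (F : mR * mR -> \bar R) (a b : R) :
  measurable_fun setT F -> (forall z, 0 <= F z) ->
  \int[lam \x lam]_(z in [set z | (a < z.1 /\ b < z.2) /\ z.2 < z.1]%R) F z =
  \int[lam]_(y in `]b, +oo[) \int[lam]_(x in `]Num.max a y, +oo[) F (x, y).
Proof.
move=> mF F0; set D := mkset _.
rewrite integral_mkcond fubini_tonelli2; first last.
- by move=> z; rewrite patchE; case: ifP.
- apply/(measurable_restrictT _ _).1; last exact: measurable_funTS.
  exact: measurable_below_diag.
rewrite [RHS]integral_mkcond; apply: eq_integral => y _.
rewrite /fubini_G patchE; case: ifPn => [|/negP] yb.
  rewrite [RHS]integral_mkcond; apply: eq_integral => x _; rewrite !patchE.
  congr (if _ then _ else _); apply/idP/idP; rewrite !inE/= !in_itv/= !andbT gt_max.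
    by move=> [[ax _] yx]; apply/andP; split.
  by move=> /andP[ax yx]; move: yb; rewrite inE/= in_itv/= andbT.
apply: integral0_eq => x _; rewrite patchE; case: ifPn => //.
by rewrite inE/= => -[[_ by_] _]; exfalso; apply: yb; rewrite inE/= in_itv/= by_.
Qed.

Lemma measurable_above_diag (a b : R) :
  measurable [set z : mR * mR | (a < z.1 /\ b < z.2) /\ z.1 < z.2]%R.
Proof.
rewrite (_ : mkset _ = setT `&` [set z : mR * mR | ((a < z.1) && (b < z.2)) && (z.1 < z.2)]%R).
  have mb : measurable_fun setT
      (fun z : mR * mR => ((a < z.1) && (b < z.2)) && (z.1 < z.2))%R.
    by do !(apply: measurable_and || apply: measurable_fun_ltr).
  by have := mb measurableT [set true] I; rewrite setTI.
by rewrite setTI; apply/seteqP; split => z/=; [case=> -[-> ->] ->|move=> /andP[/andP[-> ->] ->]].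
Qed.

Lemma integral_above_diag (F : mR * mR -> \bar R) (a b : R) :
  measurable_fun setT F -> (forall z, 0 <= F z) ->
  \int[lam \x lam]_(z in [set z | (a < z.1 /\ b < z.2) /\ z.1 < z.2]%R) F z =
  \int[lam]_(x in `]a, +oo[) \int[lam]_(y in `]Num.max b x, +oo[) F (x, y).
Proof.
move=> mF F0; set D := mkset _.
rewrite integral_mkcond fubini_tonelli1; first last.
- by move=> z; rewrite patchE; case: ifP.
- apply/(measurable_restrictT _ _).1; last exact: measurable_funTS.
  exact: measurable_above_diag.
rewrite [RHS]integral_mkcond; apply: eq_integral => x _.
rewrite /fubini_F patchE; case: ifPn => [|/negP] xa.
  rewrite [RHS]integral_mkcond; apply: eq_integral => y _; rewrite !patchE.
  congr (if _ then _ else _); apply/idP/idP; rewrite !inE/= !in_itv/= !andbT gt_max.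
    by move=> [[_ bx] yx]; apply/andP; split.
  by move=> /andP[ax yx]; move: xa; rewrite inE/= in_itv/= andbT.
apply: integral0_eq => y _; rewrite patchE; case: ifPn => //.
by rewrite inE/= => -[[ax _] _]; exfalso; apply: xa; rewrite inE/= in_itv/= ax.
Qed.

End Tonelli.

(** * Sign of the density and its mass on one side of the diagonal *)

Section Mass.
Context (R : realType) (n m : nat) (B : 'I_m -> 'M[R]_n).
Hypotheses (hQ : forall k, intensity_matrix (absorbing_Q (B k)))
  (uB : forall k, B k \in unitmx).
Context (t : R) (pit : 'cV[R]_n) (St : 'I_m -> 'M[R]_n).
Hypothesis v0 : forall k i, 0 <= (pit^T *m St k) ord0 i.
Local Notation mR := (measurableTypeR R).
Local Notation lam := (@lebesgue_measure R).

Lemma stochastically_closed_for Gam : stochastically_closed B Gam ->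
  forall k, closed_for (B k) Gam.
Proof. by move=> c k i j iG jG; rewrite -absorbing_QE c. Qed.

Lemma row_expm_ge0 k s i : 0 <= s -> 0 <= (pit^T *m St k *m expm (s *: B k)) ord0 i.
Proof.
move=> s0; rewrite mxE; apply: sumr_ge0 => j _; rewrite mulr_ge0//.
by apply: expm_ge0 => //; exact: intensity_offdiag_ge0.
Qed.

Lemma form_ge0 k s (c : 'cV[R]_n) : 0 <= s -> (forall i, 0 <= c i ord0) ->
  0 <= (pit^T *m St k *m expm (s *: B k) *m c) ord0 ord0.
Proof.
by move=> s0 c0; rewrite mxE; apply: sumr_ge0 => j _; rewrite mulr_ge0// row_expm_ge0.
Qed.

Section TwoSets.
Context (Gam1 Gam2 : {set state n}).
Hypotheses (c1 : stochastically_closed B Gam1) (c2 : stochastically_closed B Gam2)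
  (dis : forall i : 'I_n, transient i \in Gam1 -> transient i \notin Gam2).
Let H1 : 'M[R]_n := Hmx R Gam1.
Let H2 : 'M[R]_n := Hmx R Gam2.

Lemma density1_ge0 hi lo : t <= lo -> lo <= hi ->
  0 <= density1 B Gam1 Gam2 t pit St hi lo.
Proof.
move=> tlo lohi; apply: sumr_ge0 => k _.
have := @form_ge0 k (lo - t) _ _ (fun i => kernel_ge0 (hQ k)
  (stochastically_closed_for c2 k) dis (s := hi - lo) i _).
by rewrite !mulmxA; apply; rewrite subr_ge0.
Qed.

Lemma density0_ge0 u : t <= u -> 0 <= density0 B Gam1 Gam2 t pit St u.
Proof.
move=> tu; apply: sumr_ge0 => k _.
rewrite -mulmxA; apply: form_ge0; first by rewrite subr_ge0.
exact: diagonal_kernel_ge0 (hQ k) (stochastically_closed_for c1 k)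
  (stochastically_closed_for c2 k) dis.
Qed.

Lemma Ncommutator_ge0 k (w : 'cV[R]_n) i : (forall i, 0 <= w i ord0) ->
  0 <= (- commutator (B k) H2 *m w) i ord0.
Proof.
move=> w0; rewrite mxE; apply: sumr_ge0 => j _; rewrite mulr_ge0// mxE oppr_ge0.
apply: commutator_Hmx_le0; first exact: stochastically_closed_for.
exact: intensity_offdiag_ge0.
Qed.

Lemma H1_ones_ge0 i : 0 <= (H1 *m ones R n) i ord0.
Proof. by rewrite Hmx_onesE ler0n. Qed.

(** Mass of {t1 > a, t2 > b, t2 < t1}, obtained from {t1 > c, t2 > b} by removing {t2 >= t1 > c}.
    The removed mass is the second term: -H2 B H1 1 is the rate of entering [Gam1] from outside both
    sets, and integrating e^{xB} against it from c on gives e^{cB} B^-1 H2 B H1 1. *)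
Definition lower_mass (a b : R) : R :=
  let c := Num.max a b in
  \sum_k ((pit^T *m St k *m expm ((b - t) *: B k) *m H2 *m
      expm ((c - b) *: B k) *m (H1 *m ones R n)) ord0 ord0
    - (pit^T *m St k *m expm ((c - t) *: B k) *m
      (invmx (B k) *m (H2 *m (B k *m (H1 *m ones R n))))) ord0 ord0).

(** The inner integral consumes the factor B of the kernel and leaves e^{(max(a,y)-y)B} H1 1. For y
    up to c the exponent is c - y and the integrand is an exact derivative; beyond c the exponent is
    0, and the tail of -[B, H2] H1 1 is responsible for the term in B^-1. *)
Lemma iterated_density1 a b : t <= a -> t <= b ->
  (\int[lam]_(y in `]b, +oo[) \int[lam]_(x in `]Num.max a y, +oo[)
     (density1 B Gam1 Gam2 t pit St x y)%:E = (lower_mass a b)%:E)%E.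
Proof.
move=> ta tb; set c := Num.max a b.
pose psi y := - \sum_k (pit^T *m St k *m expm ((y - t) *: B k) *m commutator (B k) H2 *m
   expm ((Num.max a y - y) *: B k) *m (H1 *m ones R n)) ord0 ord0.
transitivity (\int[lam]_(y in `]b, +oo[) (psi y)%:E)%E.
  apply: eq_integral => y; rewrite inE/= in_itv/= andbT => by_.
  pose v' k := pit^T *m St k *m expm ((y - t) *: B k) *m commutator (B k) H2.
  have E x : density1 B Gam1 Gam2 t pit St x y =
      \sum_k (v' k *m expm ((x - y) *: B k) *m (B k *m (H1 *m ones R n))) ord0 ord0.
    by apply: eq_bigr => k _; rewrite !mulmxA.
  under eq_integral do rewrite E.
  rewrite integral_expm_tail//; last first.
    move=> x; rewrite ge_max => /andP[ax yx]; rewrite -E; apply: density1_ge0 => //.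
    by rewrite (le_trans tb)// ltW.
  by congr (- _)%:E; apply: eq_bigr => k _; rewrite mulKmx.
have psi0 y : b < y -> 0 <= psi y.
  move=> by_; rewrite /psi -sumrN; apply: sumr_ge0 => k _.
  rewrite [leRHS](_ : _ = (pit^T *m St k *m expm ((y - t) *: B k) *m
      (- commutator (B k) H2 *m (expm ((Num.max a y - y) *: B k) *m (H1 *m ones R n)))) ord0 ord0);
    last by rewrite mulNmx mulmxN !mulmxA [RHS]mxE.
  apply: form_ge0.
    by rewrite subr_ge0 (le_trans tb)// ltW.
  move=> i; apply: Ncommutator_ge0 => j.
  rewrite mxE; apply: sumr_ge0 => l _; rewrite mulr_ge0//; last exact: H1_ones_ge0.
  by apply: expm_ge0; [exact: intensity_offdiag_ge0|rewrite subr_ge0 le_max lexx orbT].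
have mpsi : measurable_fun setT psi.
  apply: measurable_funN; apply: measurable_sum => k.
  have := mx_measurableM (mx_measurableM (mx_measurableM (mx_measurableM
     (@mx_measurable_cst _ mR R _ _ (pit^T *m St k))
     (mx_measurable_expm (B k) (g := fun y : mR => y - t) _))
     (@mx_measurable_cst _ mR R _ _ (commutator (B k) H2)))
     (mx_measurable_expm (B k) (g := fun y : mR => Num.max a y - y) _))
     (@mx_measurable_cst _ mR R _ _ (H1 *m ones R n)).
  apply; first exact: measurable_funB.
  by apply: measurable_funB => //; exact: measurable_maxr.
have bc : b <= c by rewrite le_max lexx orbT.
rewrite (_ : `]b, +oo[%classic = `]b, c] `|` `]c, +oo[); last first.
  by rewrite -itv_bndbnd_setU// bnd_simp.
rewrite ge0_integral_setU//=; first last.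
- apply/disj_setPS => y [/=]; rewrite !in_itv/= andbT => /andP[_ yc] cy.
  by move: (lt_le_trans cy yc); rewrite ltxx.
- move=> y [|]; rewrite /= in_itv/= ?andbT lee_fin => h; apply: psi0.
    by case/andP: h.
  exact: le_lt_trans h.
- by apply/measurable_EFinP; exact: measurable_funTS.
have -> : (\int[lam]_(y in `]b, c]) (psi y)%:E =
    \int[lam]_(y in `]b, c]) (- \sum_k (pit^T *m St k *m
      expm ((y - t) *: B k) *m commutator (B k) H2
                *m expm ((c - y) *: B k) *m (H1 *m ones R n)) ord0 ord0)%:E)%E.
  apply: eq_integral => y; rewrite inE/= in_itv/= => /andP[by_ yc].
  (* Some y satisfies b < y <= c, so c cannot be b; hence c = a, and a >= y. *)
  suff -> : c = Num.max a y by [].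
  have ca : c = a.
    apply/max_idPl; rewrite leNgt; apply/negP => ab.
    by move: (lt_le_trans by_ yc); rewrite /c (max_idPr (ltW ab)) ltxx.
  by rewrite ca; apply/esym/max_idPl; rewrite -ca.
rewrite integral_expm_commutator//.
have cE x : c <= x -> psi x = \sum_k (pit^T *m St k *m expm ((x - t) *: B k) *m
    (- commutator (B k) H2 *m (H1 *m ones R n))) ord0 ord0.
  move=> cx; rewrite /psi -sumrN; apply: eq_bigr => k _.
  have -> : Num.max a x = x by apply/max_idPr; rewrite (le_trans _ cx)// le_max lexx.
  by rewrite subrr scale0r expm0 mulmx1 mulNmx mulmxN [RHS]mxE !mulmxA.
have -> : (\int[lam]_(y in `]c, +oo[) (psi y)%:E = \int[lam]_(x in `]c, +oo[)
  (\sum_k (pit^T *m St k *m expm ((x - t) *: B k) *m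
     (- commutator (B k) H2 *m (H1 *m ones R n))) ord0 ord0)%:E)%E.
  by apply: eq_integral => y; rewrite inE/= in_itv/= andbT => /ltW cy; rewrite cE.
rewrite integral_expm_tail//; last first.
  move=> x cx; apply: sumr_ge0 => k _; apply: form_ge0.
    by rewrite subr_ge0 (le_trans tb)// (le_trans bc).
  by move=> i; apply: Ncommutator_ge0; exact: H1_ones_ge0.
rewrite -EFinD; congr (_%:E); rewrite /lower_mass -/c -sumrB -sumrB; apply: eq_bigr => k _.
set z := (_ *m _ *m expm ((c - b) *: _) *m _) _ _.
rewrite -addrA; congr (_ + _).
rewrite -!mulmxA mulNmx /commutator mulmxBl mulmxN mulmxBr -!mulmxA mulKmx//.
rewrite !mulmxA !mulmxN !mulmxBr !mulmxA.
by rewrite -opprD; congr (- _); rewrite !mxE; ring.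
Qed.

End TwoSets.
End Mass.

(** * Mass of the density on quadrants *)

Section Density.
Context (R : realType) (n m : nat) (B : 'I_m -> 'M[R]_n).
Hypotheses (hQ : forall k, intensity_matrix (absorbing_Q (B k)))
  (uB : forall k, B k \in unitmx).
Context (t : R) (pit : 'cV[R]_n) (St : 'I_m -> 'M[R]_n).
Hypothesis v0 : forall k i, 0 <= (pit^T *m St k) ord0 i.
Local Notation mR := (measurableTypeR R).
Local Notation lam := (@lebesgue_measure R).
Context (Gam1 Gam2 : {set state n}).
Hypotheses (c1 : stochastically_closed B Gam1) (c2 : stochastically_closed B Gam2)
  (dis : forall i : 'I_n, transient i \in Gam1 -> transient i \notin Gam2).
Let H1 : 'M[R]_n := Hmx R Gam1.
Let H2 : 'M[R]_n := Hmx R Gam2.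
Local Notation f := (density B Gam1 Gam2 t pit St).

(** Probability, from each state at time t and under regime k, of being outside [Gam1] at t1 and
    outside [Gam2] at t2. The earlier date must come first in the product; at t1 = t2 the branches
    agree since diagonal matrices commute. *)
Definition surv_vector k t1 t2 : 'cV[R]_n :=
  if t2 <= t1 then expm ((t2 - t) *: B k) *m (H2 *m (expm ((t1 - t2) *: B k) *m (H1 *m ones R n)))
  else expm ((t1 - t) *: B k) *m (H1 *m (expm ((t2 - t1) *: B k) *m (H2 *m ones R n))).

Definition survfun t1 t2 : R := \sum_k (pit^T *m St k *m surv_vector k t1 t2) ord0 ord0.

Let dis' : forall i : 'I_n, transient i \in Gam2 -> transient i \notin Gam1.
Proof. by move=> i; apply: contraL; exact: dis. Qed.

Lemma density_ge0 x : 0 <= point_mass Gam1 Gam2 pit -> 0 <= f x.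
Proof.
move=> pm0; case: x => x1 x2 /=.
case: ifPn => [/andP[tx2 x21]|_]; first by apply: density1_ge0 => //; exact: ltW.
case: ifPn => [/andP[tx1 x12]|_].
  (* [density2] is convertible to [density1] with the sets and the times exchanged. *)
  by apply: (@density1_ge0 _ _ _ _ hQ t pit St v0 Gam2 Gam1) => //; exact: ltW.
case: ifPn => [/andP[_ tx]|_]; first by apply: density0_ge0 => //; exact: ltW.
by case: ifPn.
Qed.

Lemma measurable_density : measurable_fun setT f.
Proof.
have mat : measurable_fun setT (fun x : mR * mR => x.1 - t) by exact: measurable_funB.
have mbt : measurable_fun setT (fun x : mR * mR => x.2 - t) by exact: measurable_funB.
have mab : measurable_fun setT (fun x : mR * mR => x.1 - x.2) by exact: measurable_funB.
have mba : measurable_fun setT (fun x : mR * mR => x.2 - x.1) by exact: measurable_funB.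
rewrite (_ : density _ _ _ _ _ _ = fun x : mR * mR =>
  if (t < x.2) && (x.2 < x.1) then density1 B Gam1 Gam2 t pit St x.1 x.2
  else if (t < x.1) && (x.1 < x.2) then density2 B Gam1 Gam2 t pit St x.1 x.2
  else if (x.1 == x.2) && (t < x.1) then density0 B Gam1 Gam2 t pit St x.1
  else if (x.1 == t) && (x.2 == t) then point_mass Gam1 Gam2 pit
  else 0); last by apply/funext => -[].
apply: measurable_fun_ifT.
- by apply: measurable_and; exact: measurable_fun_ltr.
- apply: measurable_sum => k.
  by do ! apply: (mx_measurableM (r := _)); try exact: mx_measurable_cst; exact: mx_measurable_expm.
apply: measurable_fun_ifT.
- by apply: measurable_and; exact: measurable_fun_ltr.
- apply: measurable_sum => k.
  by do ! apply: (mx_measurableM (r := _)); try exact: mx_measurable_cst; exact: mx_measurable_expm.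
apply: measurable_fun_ifT.
- by apply: measurable_and; [exact: measurable_fun_eqr|exact: measurable_fun_ltr].
- apply: measurable_sum => k.
  by do ! apply: (mx_measurableM (r := _)); try exact: mx_measurable_cst; exact: mx_measurable_expm.
apply: measurable_fun_ifT => //.
by apply: measurable_and; exact: measurable_fun_eqr.
Qed.

Lemma diag_setE t1 t2 : t <= t1 -> t <= t2 ->
  [set u : mR | t < u /\ upper_right t1 t2 (u, u)] = `]Num.max t1 t2, +oo[%classic.
Proof.
move=> tt1 tt2; apply/seteqP; split => u/=; rewrite in_itv/= andbT gt_max.
  by move=> [_ [-> ->]].
by move=> /andP[a b]; split=> //; exact: le_lt_trans tt1 a.
Qed.

Lemma integral_diag_density t1 t2 : t <= t1 -> t <= t2 -> let c := Num.max t1 t2 in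
  (\int[lam]_(u in [set u : mR | (t < u)%R /\ upper_right t1 t2 (u, u)]) (f (u, u))%:E =
   (- \sum_k (pit^T *m St k *m expm ((c - t) *: B k) *m
     (H1 *m (H2 *m ones R n)
      - invmx (B k) *m (H2 *m (B k *m (H1 *m ones R n)))
      - invmx (B k) *m (H1 *m (B k *m (H2 *m ones R n))))) ord0 ord0)%:E)%E.
Proof.
move=> tt1 tt2 c; rewrite diag_setE// -/c.
have tc : t <= c by rewrite le_max tt1.
(* u = t is excluded, though c = t is possible: at (t, t) [density] takes the value of the point
   mass. *)
have E u : c <= u -> u != t -> f (u, u) = \sum_k (pit^T *m St k *m expm ((u - t) *: B k) *m
    ((commutator (B k) H2 *m H1 + commutator (B k) H1 *m H2
         - B k *m H2 *m H1) *m ones R n)) ord0 ord0.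
  move=> cu ut /=; rewrite ltxx !andbF eqxx/= ifT; last by rewrite lt_neqAle eq_sym ut (le_trans tc).
  by apply: eq_bigr => k _; rewrite !mulmxA.
transitivity (\int[lam]_(u in `]c, +oo[) (\sum_k (pit^T *m St k *m expm ((u - t) *: B k) *m
    ((commutator (B k) H2 *m H1 + commutator (B k) H1 *m H2
         - B k *m H2 *m H1) *m ones R n)) ord0 ord0)%:E)%E.
  apply: eq_integral => u uc; have cu : c < u by move: uc; rewrite inE/= in_itv/= andbT.
  rewrite E ?(ltW cu)//.
  by rewrite gt_eqF// (le_lt_trans tc).
rewrite integral_expm_tail//; last first.
  move=> u cu; rewrite [leRHS](_ : _ = density0 B Gam1 Gam2 t pit St u).
    by apply: density0_ge0 => //; exact: le_trans cu.
  by apply: eq_bigr => k _; rewrite !mulmxA.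
congr (- _)%:E; apply: eq_bigr => k _; congr ((_ *m _) _ _).
have HH : H2 *m (H1 *m ones R n) = H1 *m (H2 *m ones R n).
  by rewrite !mulmxA Hmx_comm.
rewrite /commutator !(mulmxDl, mulNmx) !(mulmxDr, mulmxN) -!mulmxA !mulKmx// HH.
move: (H1 *m _) (invmx _ *m (H2 *m _)) (invmx _ *m (H1 *m _)) => x y z.
by apply/matrixP => i j; rewrite !mxE; ring.
Qed.

(** Let c = max(t1, t2). Of the two one-sided masses, the one whose smaller coordinate is already
    bounded below by c has H1 H2 1 at time c as its first term. This and the two terms in B^-1 all
    reappear in the diagonal integral with the opposite sign, and only the survival term of the
    other side is left. *)
Lemma integral_density_upper_right t1 t2 : t <= t1 -> t <= t2 ->
  0 <= point_mass Gam1 Gam2 pit ->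
  (\int[lam \x lam]_(x in upper_right t1 t2 `&` upper_right t t `&` [set x | x.1 <> x.2]) (f x)%:E +
   \int[lam]_(u in [set u : mR | (t < u)%R /\ upper_right t1 t2 (u, u)]) (f (u, u))%:E =
   (survfun t1 t2)%:E)%E.
Proof.
move=> tt1 tt2 pm0.
have mB (x y : 'M[R]_1) : (x - y) ord0 ord0 = x ord0 ord0 - y ord0 ord0.
  by rewrite !mxE.
(* Tonelli is applied to [density] on the whole plane, including (t, t), where [pm0] gives the
   sign. *)
have f0 x : (0 <= (f x)%:E)%E by rewrite lee_fin density_ge0.
have mf : measurable_fun setT (fun x => (f x)%:E) by apply/measurable_EFinP; exact: measurable_density.
rewrite (_ : _ `&` _ `&` _ = [set z : mR * mR | (t1 < z.1 /\ t2 < z.2) /\ z.2 < z.1] `|`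
    [set z : mR * mR | (t1 < z.1 /\ t2 < z.2) /\ z.1 < z.2]); last first.
  apply/seteqP; split => -[x y]/=.
    by move=> [[xy _]] /eqP; rewrite neq_lt => /orP[|]; [right|left].
  move=> [|] -[[xt yt] xy]; split; [|by apply/eqP; rewrite gt_eqF|
    |by apply/eqP; rewrite lt_eqF]; split => //; split => /=; exact: le_lt_trans xt || exact: le_lt_trans yt.
rewrite ge0_integral_setU//=; first last.
- by apply/disj_setPS => z/= [[_ a] [_ b]]; move: (lt_trans a b); rewrite ltxx.
- exact: measurable_funTS.
- exact: measurable_above_diag.
- exact: measurable_below_diag.
rewrite integral_below_diag// integral_above_diag//.
have -> : (\int[lam]_(y in `]t2, +oo[) \int[lam]_(x in `]Num.max t1 y, +oo[) (f (x, y))%:E =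
   (lower_mass B t pit St Gam1 Gam2 t1 t2)%:E)%E.
  rewrite -(iterated_density1 hQ uB v0 c2 dis tt1 tt2);
    apply: eq_integral => y; rewrite inE/= in_itv/= andbT => ty.
  apply: eq_integral => x; rewrite inE/= in_itv/= andbT gt_max => /andP[_ yx].
  by rewrite yx (le_lt_trans tt2 ty).
have -> : (\int[lam]_(x in `]t1, +oo[) \int[lam]_(y in `]Num.max t2 x, +oo[) (f (x, y))%:E =
   (lower_mass B t pit St Gam2 Gam1 t2 t1)%:E)%E.
  rewrite -(iterated_density1 hQ uB v0 c1 dis' tt2 tt1);
    apply: eq_integral => x; rewrite inE/= in_itv/= andbT => tx.
  apply: eq_integral => y; rewrite inE/= in_itv/= andbT gt_max => /andP[_ xy].
  by rewrite xy (le_lt_trans tt1 tx) (ltNge y x) (ltW xy) andbF.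
rewrite integral_diag_density// -!EFinD; congr (_%:E).
rewrite /lower_mass (maxC t2 t1); set c := Num.max t1 t2.
rewrite -sumrN -!big_split/=; apply: eq_bigr => k _.
rewrite /surv_vector /H1 /H2; case: (leP t2 t1) => t21.
  have -> : c = t1 by exact/max_idPl.
  rewrite subrr scale0r expm0 mulmx1 !mulmxBr !mulmxA.
  by rewrite !mB; ring.
have -> : c = t2 by exact/max_idPr/ltW.
have HH : Hmx R Gam1 *m (Hmx R Gam2 *m ones R n) = Hmx R Gam2 *m (Hmx R Gam1 *m ones R n).
  by rewrite !mulmxA Hmx_comm.
rewrite subrr scale0r expm0 mulmx1 HH !mulmxBr !mulmxA.
by rewrite !mB; ring.
Qed.

End Density.

(** * Measures on the plane *)

Section Plane.
Context (R : realType).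
Local Notation mR := (measurableTypeR R).
Local Notation lam := (@lebesgue_measure R).
Implicit Types (a b t : R).

Lemma measurable_upper_right a b : measurable (upper_right a b).
Proof.
have mb : measurable_fun setT (fun z : mR * mR => (a < z.1) && (b < z.2))%R.
  by apply: measurable_and; exact: measurable_fun_ltr.
have := mb measurableT [set true] I; rewrite setTI; congr measurable.
by apply/seteqP; split => z/=; [move=> /andP|move=> [? ?]; apply/andP].
Qed.

Lemma measurable_offdiag : measurable [set z : mR * mR | z.1 <> z.2].
Proof.
have mb : measurable_fun setT (fun z : mR * mR => z.1 != z.2).
  by apply: measurable_neg; exact: measurable_fun_eqr.
have := mb measurableT [set true] I; rewrite setTI; congr measurable.
by apply/seteqP; split => z/= /eqP.
Qed.

Lemma upper_rightI a b a' b' :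
  upper_right a b `&` upper_right a' b' = upper_right (Num.max a a') (Num.max b b').
Proof.
rewrite /upper_right; apply/seteqP; split => z /=; rewrite !gt_max.
  by move=> [[-> ->] [-> ->]].
by move=> [/andP[-> ->] /andP[-> ->]].
Qed.

Section DensityMeasure.
Context (t : R) (f : mR * mR -> R).
Hypotheses (mf : measurable_fun setT f) (f0 : forall x, 0 <= f x).
Local Open Scope ereal_scope.

Let g1 := (EFin \o f) \_ (upper_right t t `&` [set x | x.1 <> x.2]).
Let g2 : mR -> \bar R := (fun u : mR => (f (u, u))%:E) \_ [set u | (t < u)%R].
Let diag (u : mR) : mR * mR := (u, u).

Let mdiag : measurable_fun setT diag.
Proof. exact: measurable_fun_pair. Qed.

Let mg1 : measurable_fun setT g1.
Proof.
apply/(measurable_restrictT _ _).1; last by apply: measurable_funTS; exact/measurable_EFinP.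
exact: measurableI (measurable_upper_right _ _) measurable_offdiag.
Qed.

Let mg2 : measurable_fun setT g2.
Proof.
apply/(measurable_restrictT _ _).1; last first.
  by apply: measurable_funTS; apply/measurable_EFinP; exact: measurableT_comp mf mdiag.
rewrite (_ : mkset _ = `]t, +oo[%classic); first exact: measurable_itv.
by apply/seteqP; split => u/=; rewrite in_itv/= andbT.
Qed.

Let g10 x : 0 <= g1 x. Proof. by rewrite /g1 patchE; case: ifP; rewrite ?lee_fin. Qed.
Let g20 x : 0 <= g2 x. Proof. by rewrite /g2 patchE; case: ifP; rewrite ?lee_fin. Qed.

Definition density_ac (A : set (mR * mR)) := \int[lam \x lam]_(x in A) g1 x.
Let ac0 : density_ac set0 = 0. Proof. exact: integral_set0. Qed.
Let ac_ge0 A : 0 <= density_ac A. Proof. by apply: integral_ge0. Qed.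
Let ac_sigma : semi_sigma_additive density_ac.
Proof. exact: semi_sigma_additive_nng_induced. Qed.
HB.instance Definition _ := isMeasure.Build _ _ _ density_ac ac0 ac_ge0 ac_sigma.

(** Image under u -> (u, u) of the measure on the line with density [g2]. *)
Definition density_diag (A : set (mR * mR)) := \int[lam]_(u in diag @^-1` A) g2 u.
Let dg0 : density_diag set0 = 0.
Proof. by rewrite /density_diag preimage_set0; exact: integral_set0. Qed.
Let dg_ge0 A : 0 <= density_diag A. Proof. by apply: integral_ge0. Qed.
Let dg_sigma : semi_sigma_additive density_diag.
Proof.
have mpre (A : set (mR * mR)) : measurable A -> measurable (diag @^-1` A).
  by move=> mA; rewrite -[X in measurable X]setTI; exact: mdiag.
move=> F mF tF mUF; rewrite /density_diag preimage_bigcup.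
apply: (@semi_sigma_additive_nng_induced _ _ _ lam g2) => //.
- by move=> n; exact: mpre.
- apply/trivIsetP => /= i j _ _ ij; rewrite -preimage_setI.
  by move/trivIsetP : tF => /(_ _ _ _ _ ij) ->//; rewrite preimage_set0.
- by rewrite -preimage_bigcup; exact: mpre.
Qed.
HB.instance Definition _ := isMeasure.Build _ _ _ density_diag dg0 dg_ge0 dg_sigma.

Lemma exists_density_probability :
  \int[lam \x lam]_(x in upper_right t t `&` [set x | x.1 <> x.2]) (f x)%:E +
  \int[lam]_(u in [set u : mR | (t < u)%R]) (f (u, u))%:E + (f (t, t))%:E = 1 ->
  exists mu : probability (mR * mR)%type R, has_density t f mu.
Proof.
pose M : {measure set (mR * mR) -> \bar R} := measure_add (measure_add density_ac density_diag)
  (mscale (NngNum (f0 (t, t))) (@dirac _ (mR * mR)%type (t, t) R)).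
have ME A : M A = \int[lam \x lam]_(x in A `&` upper_right t t `&` [set x | x.1 <> x.2]) (f x)%:E
   + \int[lam]_(u in [set u : mR | (t < u)%R /\ A (u, u)]) (f (u, u))%:E
   + (f (t, t) * \1_A (t, t))%:E.
  rewrite [LHS]measure_addE [X in X + _ = _]measure_addE; congr (_ + _ + _).
  - by rewrite /= /density_ac /g1 -integral_mkcondr setIA.
  - rewrite /= /density_diag /g2 -integral_mkcondr; congr (integral _ _ _).
    by apply/seteqP; split => u [].
move=> M1.
have MT : M setT = 1.
  rewrite ME -[RHS]M1 setTI indicT mulr1; congr (_ + _ + _).
  by congr (integral _ _ _); apply/seteqP; split => u //= [].
(* M already has mass 1, so normalising leaves it unchanged and only supplies the structure of a
   probability; the Dirac mass is the default for a degenerate M. *)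
exists (mnormalize M (@dirac _ (mR * mR)%type (t, t) R)); split => // A mA.
rewrite -ME; transitivity (mnormalize M (@dirac _ (mR * mR)%type (t, t) R) A) => //.
by rewrite /mnormalize MT onee_eq0/= invr1 mule1.
Qed.

End DensityMeasure.

Lemma probability_concentrated (mu : probability (mR * mR)%type R) S A :
  measurable S -> measurable A -> mu S = 1%E -> mu A = mu (A `&` S).
Proof.
move=> mS mA mu1; rewrite -[in LHS](setIT A) -(setUv S) setIUr measureU; first last.
- by rewrite setIACA setICr setI0.
- by apply: measurableI => //; exact: measurableC.
- exact: measurableI.
have mu0 : mu (~` S) = 0%E by rewrite probability_setC// mu1 subee.
rewrite [X in (_ + X)%E](_ : _ = 0%E) ?adde0//.
apply/eqP; rewrite eq_le measure_ge0 andbT -mu0; apply: le_measure; rewrite ?inE//.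
- by apply: measurableI => //; exact: measurableC.
- exact: measurableC.
Qed.

(** Rationals are shifted by t so that a corner lies in the domain t1, t2 >= t of the survival
    function exactly when both rationals are nonnegative. *)
Definition rat_corners t : set (set (mR * mR)) :=
  [set A | exists p q : rat, A = upper_right (t + ratr p) (t + ratr q)].

Lemma measurable_corner t :
  measurable ([set (t, t)] `|` upper_right t t : set (mR * mR)).
Proof.
apply: measurableU; last exact: measurable_upper_right.
rewrite (_ : [set (t, t)] = [set t] `*` [set t]).
  by apply: measurableX; exact: measurable_set1.
by apply/seteqP; split => -[x y] /= [-> ->].
Qed.

Lemma maxDratr t (p q : rat) :
  Num.max (t + ratr p) (t + ratr q) = t + ratr (Num.max p q) :> R.
Proof.
rewrite -addr_maxr; congr (_ + _).
by case: (leP p q) => pq; [apply/max_idPr|apply/max_idPl]; rewrite ler_rat// ltW.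
Qed.

Lemma rat_cornersI t : setI_closed (rat_corners t).
Proof.
move=> _ _ [p [q ->]] [p' [q' ->]]; exists (Num.max p p'), (Num.max q q').
by rewrite upper_rightI !maxDratr.
Qed.

(** Both projections are measurable for the generated sigma-field: {a < z.1} is the countable union
    of the quadrants whose first corner coordinate is at least a, and similarly for z.2. *)
Lemma measurable_rat_corners t (A : set (mR * mR)) :
  measurable A -> <<s rat_corners t >> A.
Proof.
move=> mA; pose T' := g_sigma_algebraType (rat_corners t).
have mC (p q : rat) : measurable (upper_right (t + ratr p) (t + ratr q) : set T').
  by apply: sub_sigma_algebra; exists p, q.
have m1 : measurable_fun setT (fst : T' -> mR).
  apply: (measurability _ (RGenOInfty.measurableE R)) => /= _ [_ [a ->] <-].
  rewrite setTI (_ : _ @^-1` _ = \bigcup_(p : rat) \bigcup_(q : rat)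
     (if a <= t + ratr p then upper_right (t + ratr p) (t + ratr q) else set0)).
    apply: bigcupT_measurable_rat => p; apply: bigcupT_measurable_rat => q.
    by case: ifP => _; [exact: mC|exact: measurable0].
  apply/seteqP; split => z /=.
    rewrite in_itv/= andbT => az.
    have [|p] := @rat_in_itvoo R (a - t) (z.1 - t); first by rewrite ltrD2r.
    rewrite inE/= => /andP[ap pz].
    (* Any q with t + q < z.2 will do; the bound -1 merely provides an interval to choose it
       from. *)
    have [|q] := @rat_in_itvoo R (z.2 - t - 1) (z.2 - t); first by rewrite ltrBlDr ltrDl.
    rewrite inE/= => /andP[_ qz].
    exists p => //; exists q => //; rewrite ifT; last by rewrite -lerBlDl ltW.
    by split; rewrite /= addrC -ltrBrDr.
  move=> [p _ [q _]]; case: ifPn => // ap [/= pz _]; rewrite in_itv/= andbT.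
  exact: le_lt_trans pz.
have m2 : measurable_fun setT (snd : T' -> mR).
  apply: (measurability _ (RGenOInfty.measurableE R)) => /= _ [_ [a ->] <-].
  rewrite setTI (_ : _ @^-1` _ = \bigcup_(p : rat) \bigcup_(q : rat)
     (if a <= t + ratr q then upper_right (t + ratr p) (t + ratr q) else set0)).
    apply: bigcupT_measurable_rat => p; apply: bigcupT_measurable_rat => q.
    by case: ifP => _; [exact: mC|exact: measurable0].
  apply/seteqP; split => z /=.
    rewrite in_itv/= andbT => az.
    have [|q] := @rat_in_itvoo R (a - t) (z.2 - t); first by rewrite ltrD2r.
    rewrite inE/= => /andP[aq qz].
    have [|p] := @rat_in_itvoo R (z.1 - t - 1) (z.1 - t); first by rewrite ltrBlDr ltrDl.
    rewrite inE/= => /andP[_ pz].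
    exists p => //; exists q => //; rewrite ifT; last by rewrite -lerBlDl ltW.
    by split; rewrite /= addrC -ltrBrDr.
  move=> [p _ [q _]]; case: ifPn => // ap [/= _ qz]; rewrite in_itv/= andbT.
  exact: le_lt_trans qz.
have mid : measurable_fun setT (fun x : T' => (x.1, x.2) : mR * mR).
  exact: measurable_fun_pair.
have := mid measurableT A mA; rewrite setTI.
rewrite (_ : _ @^-1` A = A)//.
by apply/seteqP; split => -[].
Qed.

(** The pi-system also has corners below t. If both coordinates are below t, the quadrant contains
    the support; otherwise it misses (t, t), and its trace on the support is the quadrant with the
    corner raised to t. *)
Lemma eq_probability_rat_corners t (m1 m2 : probability (mR * mR)%type R) :
  m1 ([set (t, t)] `|` upper_right t t) = 1%E ->
  m2 ([set (t, t)] `|` upper_right t t) = 1%E ->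
  (forall p q : rat, 0 <= p -> 0 <= q ->
    m1 (upper_right (t + ratr p) (t + ratr q)) = m2 (upper_right (t + ratr p) (t + ratr q))) ->
  forall A, measurable A -> m1 A = m2 A.
Proof.
move=> s1 s2 e A /(@measurable_rat_corners t).
set S := _ `|` _ in s1 s2.
have mS : measurable S by exact: measurable_corner.
have trE (p q : rat) (m : probability (mR * mR)%type R) : m S = 1%E ->
    m (upper_right (t + ratr p) (t + ratr q)) =
    if (p < 0) && (q < 0) then 1%E
    else m (upper_right (t + ratr (Num.max p 0)) (t + ratr (Num.max q 0))).
  move=> mS1; rewrite (probability_concentrated mS (measurable_upper_right _ _) mS1).
  case: ifPn => [/andP[p0 q0]|pq].
    rewrite setIidr// => -[z1 z2] [[-> ->]|[/= tz1 tz2]]; split => /=.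
    - by rewrite gtrDl ltrq0.
    - by rewrite gtrDl ltrq0.
    - by rewrite (lt_trans _ tz1)// gtrDl ltrq0.
    - by rewrite (lt_trans _ tz2)// gtrDl ltrq0.
  congr (m _); rewrite -!maxDratr rmorph0 addr0 -upper_rightI.
  apply/seteqP; split => -[z1 z2] [h1 h2]; split => //; last by right.
  case: h2 => // -[e1 e2]; exfalso; move: h1; rewrite e1 e2 => -[/=].
  by rewrite !gtrDl !ltrq0 => p0 q0; rewrite p0 q0 in pq.
have agree p q : m1 (upper_right (t + ratr p) (t + ratr q)) = m2 (upper_right (t + ratr p) (t + ratr q)).
  rewrite (trE p q m1 s1) (trE p q m2 s2); case: ifP => // _.
  by apply: e; rewrite le_max lexx orbT.
have HE : [set X | rat_corners t X /\ X `<=` setT] = rat_corners t.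
  by apply/seteqP; split => X; [case|].
rewrite -HE; apply: (@g_sigma_algebra_measure_unique_trace _ _ _ (rat_corners t) setT) => //.
- by rewrite HE => _ [p [q ->]]; exact: measurable_upper_right.
- by rewrite HE; exact: rat_cornersI.
- by rewrite [LHS]probability_setT [RHS]probability_setT.
- by rewrite HE => _ [p [q ->]]; exact: agree.
- by rewrite [X in (X < _)%E]probability_setT ltry.
Qed.

End Plane.

(** * Markov property *)

Section MeasureFacts.
Context d (T : measurableType d) (R : realType) (P : probability T R).

Lemma measure_fintype_partition (I : finType) (Y : T -> I) (A : set T) :
  measurable A -> (forall i, measurable [set w | Y w = i]) ->
  P A = (\sum_(i : I) P (A `&` [set w | Y w = i]))%E.
Proof.
move=> mA mY.
have ms (s : seq I) : measurable [set w | Y w \in s].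
  elim: s => [|i s IHs].
    rewrite (_ : mkset _ = set0); first exact: measurable0.
    by apply/seteqP; split => w.
  rewrite (_ : mkset _ = [set w | Y w = i] `|` [set w | Y w \in s]); first exact: measurableU.
  apply/seteqP; split => w /=; rewrite inE; first by case/predU1P; [left|right].
  by move=> [->|->]; rewrite ?eqxx// orbT.
have key (s : seq I) : uniq s ->
    P (A `&` [set w | Y w \in s]) = (\sum_(i <- s) P (A `&` [set w | Y w = i]))%E.
  elim: s => [_|i s IHs /= /andP[nis us]].
    by rewrite big_nil (_ : _ `&` _ = set0) ?measure0//; apply/seteqP; split => w // [].
  rewrite big_cons -IHs// -measureU.
  - congr (P _); apply/seteqP; split => w /=; rewrite inE.
      by move=> [Aw /predU1P[]]; [left|right].
    by move=> [[Aw ->]|[Aw ->]]; rewrite ?eqxx ?orbT.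
  - exact: measurableI.
  - exact: measurableI.
  - by apply/seteqP; split => w // -[[_ wi] [_]] /=; move: wi => /= ->; rewrite (negbTE nis).
rewrite -key ?index_enum_uniq// (_ : [set w | _] = setT) ?setIT//.
by apply/seteqP; split => w //= _; rewrite mem_index_enum.
Qed.

Lemma eq_measure_ae (A A' : set T) : measurable A -> measurable A' ->
  {ae P, forall w, A w <-> A' w} -> P A = P A'.
Proof.
move=> mA mA' [N [mN N0 AN]].
have E (C : set T) : measurable C -> P C = P (C `&` ~` N).
  move=> mC; rewrite -[in LHS](setIT C) -(setUv N) setIUr measureU; first last.
  - by rewrite setIACA setICr setI0.
  - by apply: measurableI => //; exact: measurableC.
  - exact: measurableI.
  rewrite [X in (X + _)%E](_ : _ = 0%E) ?add0e//.
  apply/eqP; rewrite eq_le measure_ge0 andbT -N0; apply: le_measure; rewrite ?inE//.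
  exact: measurableI.
rewrite E// (E A')//; congr (P _); apply/seteqP; split => w [Aw nN]; split => //.
  by have /= [AA' _] := contra_notP (AN w) nN; exact: AA'.
by have /= [_ A'A] := contra_notP (AN w) nN; exact: A'A.
Qed.

End MeasureFacts.

Section Markov.
Context d (T : measurableType d) (R : realType) (P : probability T R) (n m : nat)
  (B : 'I_m -> 'M[R]_n) (p0 : 'I_n -> R) (s0 : 'I_n -> 'I_m -> R)
  (phi : T -> 'I_m) (X : R -> T -> state n).
Hypothesis hX : mixture_process P B p0 s0 phi X.
Implicit Types (s : seq (R * state n)) (k : 'I_m) (i j l : state n).

(** Constraints are kept in a list: concatenation is intersection, which yields a pi-system, and
    order is irrelevant, so dates can be sorted at will. *)
Definition cylinder s : set T := [set w | forall c, c \in s -> X c.1 w = c.2].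
Definition regime k : set T := [set w | phi w = k].
Definition at_state (u : R) j : set T := [set w | X u w = j].

Let leq1 (a b : R * state n) := a.1 <= b.1.

Lemma measurable_regime k : measurable (regime k).
Proof. exact: (mix_phi_measurable hX). Qed.

Lemma measurable_at_state u j : 0 <= u -> measurable (at_state u j).
Proof. by move=> u0; exact: (mix_X_measurable hX). Qed.

Lemma cylinder_nil : cylinder [::] = setT.
Proof. by apply/seteqP; split. Qed.

Lemma cylinder_cat s s' : cylinder (s ++ s') = cylinder s `&` cylinder s'.
Proof.
apply/seteqP; split => w /=.
  by move=> h; split => c cs; apply: h; rewrite mem_cat cs ?orbT.
by move=> [h h'] c; rewrite mem_cat => /orP[]; [exact: h|exact: h'].
Qed.

Lemma cylinder1 c : cylinder [:: c] = at_state c.1 c.2.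
Proof.
apply/seteqP; split => w /=; first by move=> /(_ c); rewrite inE eqxx => /(_ isT).
by move=> h c'; rewrite inE => /eqP ->.
Qed.

Lemma cylinder_rcons s c : cylinder (rcons s c) = cylinder s `&` at_state c.1 c.2.
Proof. by rewrite -cats1 cylinder_cat cylinder1. Qed.

Lemma eq_cylinder s s' : s =i s' -> cylinder s = cylinder s'.
Proof. by move=> e; apply/seteqP; split => w h c; [rewrite -e|rewrite e]; exact: h. Qed.

Lemma measurable_cylinder s : all (fun c => 0 <= c.1) s -> measurable (cylinder s).
Proof.
elim: s => [_|c s IHs /= /andP[c0 s0']]; first by rewrite cylinder_nil.
rewrite -cat1s cylinder_cat cylinder1; apply: measurableI; last exact: IHs.
exact: measurable_at_state.
Qed.

Lemma subset_probability0 (A C : set T) : measurable A -> measurable C -> A `<=` C ->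
  P C = 0%E -> P A = 0%E.
Proof.
by move=> mA mC AC C0; apply/eqP; rewrite eq_le measure_ge0 andbT -C0 le_measure ?inE.
Qed.

(** In product form the Markov property survives a null past, where both sides vanish; the
    normalisations by P C in [pcond] cancel. *)
Lemma markov_initial k (x : 'I_n) s u i r j :
  sorted leq1 (rcons (rcons s (u, i)) (r, j)) ->
  all (fun c => 0 <= c.1) (rcons (rcons s (u, i)) (r, j)) ->
  let C := regime k `&` at_state 0 (transient x) in
  P (cylinder (rcons (rcons s (u, i)) (r, j)) `&` C) =
  (P (cylinder (rcons s (u, i)) `&` C) * (expm ((r - u) *: absorbing_Q (B k)) i j)%:E)%E.
Proof.
move=> sort_l pos_l C.
have mC : measurable C by apply: measurableI; [exact: measurable_regime|exact: measurable_at_state].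
move: (pos_l); rewrite all_rcons => /andP[/= r0 pos_s].
have mcyl : measurable (cylinder (rcons s (u, i))) by exact: measurable_cylinder.
have mpast : measurable (cylinder (rcons s (u, i)) `&` C) by exact: measurableI.
have mfut : measurable (cylinder (rcons (rcons s (u, i)) (r, j)) `&` C).
  by apply: measurableI => //; exact: measurable_cylinder.
have [past0|pastN0] := eqVneq (P (cylinder (rcons s (u, i)) `&` C)) 0%E.
  rewrite past0 mul0e (subset_probability0 mfut mpast _ past0)//.
  by apply: setSI; rewrite cylinder_rcons => w [].
have CN0 : P C != 0%E.
  by apply: contraNneq pastN0 => C0; apply/eqP/(subset_probability0 mpast mC) => // w [].
have Cgt0 : (0 < P C)%E by rewrite lt_neqAle eq_sym CN0 measure_ge0.
have [_ /(_ (size s))] := mix_markov hX Cgt0.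
set L := rcons (rcons s (u, i)) (r, j).
have sL : size L = (size s).+2 by rewrite !size_rcons.
(* Dates and states are read off L with N = [size s]: entry N is (u, i), the end of the past, and
   entry N + 1 is (r, j). *)
move=> /(_ (fun q => (nth (u, i) L q).1) (fun q => (nth (u, i) L q).2)).
have nthu : nth (u, i) L (size s) = (u, i).
  by rewrite /L nth_rcons size_rcons ltnSn nth_rcons ltnn eqxx.
have nthr : nth (u, i) L (size s).+1 = (r, j).
  by rewrite /L nth_rcons size_rcons ltnn eqxx.
rewrite nthu nthr /=.
have pastE :
    [set w | forall q : nat, (q <= size s)%N -> X (nth (u, i) L q).1 w = (nth (u, i) L q).2] =
    cylinder (rcons s (u, i)).
  have nthl q : (q <= size s)%N -> nth (u, i) L q = nth (u, i) (rcons s (u, i)) q.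
    by move=> qs; rewrite /L nth_rcons size_rcons ltnS qs.
  apply/seteqP; split => w /= h.
    move=> c /(nthP (u, i))[q]; rewrite size_rcons ltnS => qs <-.
    by have := h q qs; rewrite nthl.
  by move=> q qs; rewrite nthl//; apply: h; rewrite mem_nth// size_rcons ltnS.
rewrite pastE => H.
have fP (A : set T) : measurable A -> (fine (P A))%:E = P A.
  by move=> mA; rewrite fineK// fin_num_measure.
have H1 : 0 < fine (P C) by rewrite fine_gt0// Cgt0/= ltey_eq fin_num_measure.
have H2 : 0 < fine (P (cylinder (rcons s (u, i)) `&` C)).
  by rewrite fine_gt0// ltey_eq fin_num_measure// andbT lt_neqAle eq_sym pastN0 measure_ge0.
have h0 : 0 <= (nth (u, i) L 0).1 by apply: (allP pos_l); rewrite mem_nth// sL.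
have h1 q : (q <= size s)%N -> (nth (u, i) L q).1 <= (nth (u, i) L q.+1).1.
  by move=> qs; apply: (sortedP (u, i) sort_l); rewrite sL !ltnS.
have := H h0 h1; rewrite /pcond => {}H.
have {}H := H (divr_gt0 H2 H1).
rewrite -/(at_state r j) in H.
rewrite -H -(fP _ mpast) -EFinM -(fP _ mfut); congr (_%:E).
rewrite cylinder_rcons (setIC (cylinder _) (at_state _ _)).
move: (fine (P (_ `&` C))) (fine (P (cylinder (rcons s (u, i)) `&` C))) (fine (P C)) H1 H2.
move=> x1 x2 x3 H1 H2.
rewrite /=; by field; rewrite !gt_eqF.
Qed.

(** The cell X_0 = Delta is null. *)
Lemma split_initial k (A : set T) : measurable A ->
  P (A `&` regime k) = (\sum_(x : 'I_n) P (A `&` (regime k `&` at_state 0 (transient x))))%E.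
Proof.
move=> mA; have mAk : measurable (A `&` regime k) by apply: measurableI => //; exact: measurable_regime.
rewrite (measure_fintype_partition P (Y := X 0))//; last by move=> i; exact: measurable_at_state.
rewrite big_split_ord/= big_ord1 [X in (_ + X)%E](_ : _ = 0%E) ?adde0.
  by apply: eq_bigr => x _; rewrite setIA.
have mD : measurable (at_state 0 (Delta n)) by exact: measurable_at_state.
apply: (subset_probability0 _ mD _ (mix_initial_Delta hX)); last by move=> w [].
by apply: measurableI.
Qed.

Lemma markov_regime k s u i r j :
  sorted leq1 (rcons (rcons s (u, i)) (r, j)) ->
  all (fun c => 0 <= c.1) (rcons (rcons s (u, i)) (r, j)) ->
  P (cylinder (rcons (rcons s (u, i)) (r, j)) `&` regime k) =
  (P (cylinder (rcons s (u, i)) `&` regime k) * (expm ((r - u) *: absorbing_Q (B k)) i j)%:E)%E.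
Proof.
move=> sort_l pos_l.
rewrite split_initial; last exact: measurable_cylinder.
rewrite split_initial; last by apply: measurable_cylinder; move: pos_l; rewrite all_rcons => /andP[].
rewrite ge0_sume_distrl; last by move=> x _; exact: measure_ge0.
by apply: eq_bigr => x _; exact: markov_initial.
Qed.

Lemma sorted_rcons_le s c : sorted leq1 s -> all (fun c' => c'.1 <= c.1) s ->
  sorted leq1 (rcons s c).
Proof.
case: s => [//|a s] sa /allP ac; rewrite rcons_cons/= rcons_path.
by apply/andP; split => //; apply: ac; exact: mem_last.
Qed.

Lemma expm_absorbing_ge0 k q i j : 0 <= q -> 0 <= expm (q *: absorbing_Q (B k)) i j.
Proof. by move=> q0; apply: expm_ge0 => //; have [] := mix_intensity hX k. Qed.

(* The Markov property extends from cylinder sets to the strict past by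
   uniqueness of finite measures on a pi-system. *)
Lemma markov_strict_past k t r v i j l (C : set T) :
  0 <= t -> t <= r -> r <= v -> strict_past X t C ->
  P (C `&` (regime k `&` at_state t i `&` at_state r j `&` at_state v l)) =
  (P (C `&` (regime k `&` at_state t i)) *
    (expm ((r - t) *: absorbing_Q (B k)) i j * expm ((v - r) *: absorbing_Q (B k)) j l)%:E)%E.
Proof.
move=> t0 tr rv XC.
have r0 := le_trans t0 tr; have v0 := le_trans r0 rv.
pose G := [set A : set T | exists s, all (fun c => (0 <= c.1) && (c.1 < t)) s /\ A = cylinder s].
have mE2 : measurable (regime k `&` at_state t i).
  by apply: measurableI; [exact: measurable_regime|exact: measurable_at_state].
have mE1 : measurable (regime k `&` at_state t i `&` at_state r j `&` at_state v l).
  by do 2 (apply: measurableI; last exact: measurable_at_state).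
have q0 : 0 <= expm ((r - t) *: absorbing_Q (B k)) i j * expm ((v - r) *: absorbing_Q (B k)) j l.
  by rewrite mulr_ge0 ?expm_absorbing_ge0 ?subr_ge0.
have posG s : all (fun c => (0 <= c.1) && (c.1 < t)) s -> all (fun c => 0 <= c.1) s.
  by apply: sub_all => c /andP[].
have GE A : G A -> P (A `&` (regime k `&` at_state t i `&` at_state r j `&` at_state v l)) =
  (P (A `&` (regime k `&` at_state t i)) *
    (expm ((r - t) *: absorbing_Q (B k)) i j * expm ((v - r) *: absorbing_Q (B k)) j l)%:E)%E.
  (* Sorting leaves the event unchanged and puts the dates in the order that the Markov property
     asks for. *)
  move=> [s [sG ->]]; pose s1 := sort leq1 s.
  have -> : cylinder s = cylinder s1 by apply: eq_cylinder => c; rewrite mem_sort.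
  have srt : sorted leq1 s1 by apply: sort_sorted => a b; exact: le_total.
  have s1t : all (fun c => c.1 <= t) s1.
    by rewrite all_sort; apply: sub_all sG => c /andP[_ /ltW].
  have s10 : all (fun c => 0 <= c.1) s1 by rewrite all_sort; exact: posG.
  have srt2 : sorted leq1 (rcons (rcons s1 (t, i)) (r, j)).
    apply: sorted_rcons_le; first exact: sorted_rcons_le.
    by rewrite all_rcons/= tr; apply: sub_all s1t => c /le_trans; apply.
  have srt3 : sorted leq1 (rcons (rcons (rcons s1 (t, i)) (r, j)) (v, l)).
    apply: sorted_rcons_le => //.
    rewrite !all_rcons/= rv (le_trans tr rv)/=; apply: sub_all s1t => c /le_trans; apply.
    exact: le_trans rv.
  rewrite EFinM muleA.
  have -> : cylinder s1 `&` (regime k `&` at_state t i `&` at_state r j `&` at_state v l) =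
      cylinder (rcons (rcons (rcons s1 (t, i)) (r, j)) (v, l)) `&` regime k.
    rewrite !cylinder_rcons/=; apply/seteqP; split => w.
      by move=> [? [[[? ?] ?] ?]]; do !split.
    by move=> [[[[? ?] ?] ?] ?]; do !split.
  have -> : cylinder s1 `&` (regime k `&` at_state t i) = cylinder (rcons s1 (t, i)) `&` regime k.
    by rewrite !cylinder_rcons/= setIA setIAC.
  rewrite markov_regime//; last by rewrite !all_rcons/= v0 r0 t0.
  by rewrite markov_regime//; rewrite !all_rcons/= r0 t0.
have HE : [set A | G A /\ A `<=` setT] = G by apply/seteqP; split => A; [case|].
(* [setT] is the cylinder without constraints, which settles the equality of the total masses. *)
have GT : G setT by exists [::]; rewrite cylinder_nil.
have := @g_sigma_algebra_measure_unique_trace _ _ _ G setT _ _ _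
  (mrestr P mE1) (mscale (NngNum q0) (mrestr P mE2)).
rewrite HE => U.
have {U} := U measurableT.
have Gm : G `<=` measurable.
  by move=> _ [s [sG ->]]; apply: measurable_cylinder; exact: posG.
have GI : setI_closed G.
  move=> _ _ [s [sG ->]] [s' [s'G ->]]; exists (s ++ s'); split; last by rewrite cylinder_cat.
  by rewrite all_cat sG.
have E A : G A -> mrestr P mE1 A = mscale (NngNum q0) (mrestr P mE2) A.
  by move=> GA; rewrite /mscale /mrestr/= muleC; exact: GE.
move=> /(_ Gm GI (E _ GT) E) U.
have GC : <<s G >> C.
  apply: smallest_sub XC; first exact: smallest_sigma_algebra.
  move=> _ [u [x [u0 ut ->]]]; apply: sub_sigma_algebra; exists [:: (u, x)]; split.
    by rewrite /= u0 ut.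
  by rewrite cylinder1.
have := U _ _ C GC; rewrite /mscale /mrestr/= [in X in _ -> X]muleC; apply => //.
rewrite (@le_lt_trans _ _ 1%E) ?ltry//; apply: probability_le1; exact: measurableI.
Qed.

End Markov.

(** * Hitting times *)

Lemma sum_pair_ereal (R : realType) (I J : finType) (F : I * J -> \bar R) :
  (\sum_p F p = \sum_i \sum_j F (i, j))%E.
Proof. by rewrite pair_bigA; apply: eq_bigr => -[]. Qed.

Section Hitting.
Context d (T : measurableType d) (R : realType) (P : probability T R) (n m : nat)
  (B : 'I_m -> 'M[R]_n) (p0 : 'I_n -> R) (s0 : 'I_n -> 'I_m -> R)
  (phi : T -> 'I_m) (X : R -> T -> state n).
Hypothesis hX : mixture_process P B p0 s0 phi X.
Implicit Types (k : 'I_m) (i j l : state n) (Gam : {set state n}).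

(** States being discrete, right continuity freezes X on some [u, u + e). A path avoiding [Gam] up
    to u therefore avoids it until u + e, and the infimum exceeds u strictly. *)
Lemma hitting_time_gtP Gam u w : 0 <= u ->
  (u%:E < hitting_time X Gam w)%E <-> forall v, 0 <= v -> v <= u -> X v w \notin Gam.
Proof.
move=> u0; split=> [uh v v0 vu|h].
  apply/negP => vG; move: uh; rewrite ltNge => /negP; apply.
  by apply: (@le_trans _ _ v%:E); [apply: ereal_inf_lbound; exists v|rewrite lee_fin].
have [e /= e0 he] := mix_right_continuous hX w u0.
apply: (@lt_le_trans _ _ (u + e)%:E); first by rewrite lte_fin ltrDl.
apply: le_ereal_inf_tmp => _ [v [v0 vG] <-]; rewrite lee_fin leNgt; apply/negP => vue.
have [vu|uv] := leP v u; first by move: (h v v0 vu); rewrite vG.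
have := he v; rewrite /ball/= => /(_ _ uv) XE.
move: (h u u0 (lexx _)); rewrite -XE ?vG//.
by rewrite distrC gtr0_norm ?subr_gt0// ltrBlDl.
Qed.

Definition avoids Gam u : set T := [set w | X u w \notin Gam].

Lemma measurable_avoids Gam u : 0 <= u -> measurable (avoids Gam u).
Proof.
move=> u0; rewrite (_ : avoids Gam u =
    \big[setU/set0]_(j : state n) (if j \notin Gam then at_state X u j else set0)).
  by apply: bigsetU_measurable => j _; case: ifP => // _; exact: (measurable_at_state hX).
apply/seteqP; split => w; rewrite -bigcup_seq/=.
  by move=> h; exists (X u w) => /=; [rewrite mem_index_enum|rewrite h].
by move=> [j _]; case: ifPn => //= jG; rewrite /avoids/= => ->.
Qed.

(** Split by the regime, X_q and X_u: each cell of the exceptional event has as a factor a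
    transition probability out of the closed set, which is 0. *)
Lemma closed_set_absorbing Gam q u : stochastically_closed B Gam -> 0 <= q -> q <= u ->
  {ae P, forall w, X q w \in Gam -> X u w \in Gam}.
Proof.
move=> cG q0 qu; have u0 := le_trans q0 qu.
have mI : measurable ([set w | X q w \in Gam] `&` avoids Gam u).
  apply: measurableI; last exact: measurable_avoids.
  rewrite (_ : mkset _ = ~` avoids Gam q).
    by apply: measurableC; exact: measurable_avoids.
  by apply/seteqP; split => w /=; rewrite /avoids/=; [move=> ->|move=> /negP; rewrite negbK].
exists ([set w | X q w \in Gam] `&` avoids Gam u); split => //; last first.
  by move=> w /= /not_implyP[? /negP].
rewrite (measure_fintype_partition P (Y := fun w => (phi w, (X q w, X u w))))//; last first.
  move=> [k [j l]].
  rewrite (_ : mkset _ = regime phi k `&` at_state X q j `&` at_state X u l).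
    apply: measurableI; last exact: (measurable_at_state hX).
    by apply: measurableI; [exact: (measurable_regime hX)|exact: (measurable_at_state hX)].
  apply/seteqP; split => w; first by move=> [<- <- <-]; do !split.
  by move=> [[e1 e2] e3]; congr (_, (_, _)).
apply: big1 => -[k [j l]] _.
have [jG|jG] := boolP (j \in Gam); last first.
  rewrite (_ : _ `&` _ = set0) ?measure0//; apply/seteqP; split => // w [[/= h _] [_ e _]].
  by move: jG; rewrite -e h.
have [lG|lG] := boolP (l \in Gam).
  rewrite (_ : _ `&` _ = set0) ?measure0//; apply/seteqP; split => // w [[/= _ h] [_ _ e]].
  by move: h; rewrite /avoids/= e lG.
have H := markov_regime hX k (s := [::]) (u := q) (i := j) (r := u) (j := l).
have M0 : P (cylinder X [:: (q, j); (u, l)] `&` regime phi k) = 0%E.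
  rewrite [LHS]H/= ?qu ?q0 ?u0//.
  by rewrite (@expm_closed0 _ _ _ [pred i | i \in Gam]) ?mule0// => i i'; exact: cG.
apply: (subset_probability0 _ _ _ M0).
- apply: measurableI => //.
  rewrite (_ : mkset _ = regime phi k `&` at_state X q j `&` at_state X u l).
    apply: measurableI; last exact: (measurable_at_state hX).
    by apply: measurableI; [exact: (measurable_regime hX)|exact: (measurable_at_state hX)].
  apply/seteqP; split => w; first by move=> [<- <- <-]; do !split.
  by move=> [[e1 e2] e3]; congr (_, (_, _)).
- apply: measurableI; last exact: (measurable_regime hX).
  by apply: (measurable_cylinder hX); rewrite /= q0 u0.
- by move=> w [_ [e0 e1 e2]]; split => // c; rewrite !inE => /orP[] /eqP ->.
Qed.

Definition not_hit Gam (u : R) : set T := [set w | (u%:E < hitting_time X Gam w)%E].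

(** A visit before u lasts for some time and so contains a rational date before u. The date u is
    listed apart, since a visit starting there can be seen only after u. *)
Lemma not_hitE Gam u : 0 <= u -> not_hit Gam u = avoids Gam u `&`
  \bigcap_(q : rat) [set w | 0 <= ratr q :> R -> ratr q < u -> X (ratr q) w \notin Gam].
Proof.
move=> u0; apply/seteqP; split => w.
  move=> /(hitting_time_gtP Gam w u0) h; split; first exact: h.
  by move=> q _ /= q0 qu; apply: h => //; exact: ltW.
move=> [hu hq]; apply/(hitting_time_gtP Gam w u0) => v v0.
rewrite le_eqVlt => /predU1P[->//|vu].
have [e /= e0 he] := mix_right_continuous hX w v0.
have [|q] := @rat_in_itvoo R v (Num.min u (v + e)).
  by rewrite lt_min vu ltrDl.
rewrite inE/= => /andP[vq]; rewrite bnd_simp lt_min => /andP[qu qe].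
rewrite -(he (ratr q))//; first by apply: hq => //=; exact: ltW (le_lt_trans v0 vq).
by rewrite /ball/= distrC gtr0_norm ?subr_gt0// ltrBlDl.
Qed.

Lemma measurable_not_hit Gam u : 0 <= u -> measurable (not_hit Gam u).
Proof.
move=> u0; rewrite not_hitE//; apply: measurableI; first exact: measurable_avoids.
rewrite -(setCK (\bigcap_(q in _) _)) setC_bigcap; apply: measurableC.
apply: bigcupT_measurable_rat => q; apply: measurableC.
have [q0|q0] := leP 0 (ratr q : R); last first.
  rewrite (_ : mkset _ = setT); first exact: measurableT.
  by apply/seteqP; split => // w _ /=; rewrite leNgt q0.
have [qu|qu] := ltP (ratr q : R) u; last first.
  rewrite (_ : mkset _ = setT); first exact: measurableT.
  by apply/seteqP; split => // w _ /= _; rewrite ltNge qu.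
rewrite (_ : mkset _ = avoids Gam (ratr q)); first exact: measurable_avoids.
by apply/seteqP; split => w /=; [exact|move=> h _ _].
Qed.

Lemma not_hit_ae Gam u : stochastically_closed B Gam -> 0 <= u ->
  {ae P, forall w, not_hit Gam u w <-> avoids Gam u w}.
Proof.
move=> cG u0; rewrite not_hitE//.
(* [ae_foralln] ranges over nat, hence an enumeration of the rationals; 0 is the value at integers
   that code nothing. *)
have [dec decP] : exists dec : nat -> rat, forall q, exists N, dec N = q.
  exists (fun N => odflt 0 (unpickle N)) => q; exists (pickle q).
  by rewrite pickleK.
have : {ae P, forall w, forall N : nat,
    0 <= ratr (dec N) :> R -> ratr (dec N) < u -> X (ratr (dec N)) w \in Gam -> X u w \in Gam}.
  apply: ae_foralln => N; move: (dec N) => q.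
  have [q0|q0] := leP 0 (ratr q : R); last by apply: aeW => w.
  have [qu|qu] := ltP (ratr q : R) u; last by apply: aeW => w.
  have := closed_set_absorbing cG q0 (ltW qu).
  by apply: filterS => w h _ _.
apply: filterS => w h; split=> [[]//|au]; split => // q _ /= q0 qu.
have [N Nq] := decP q; subst q; apply/negP => /(h N q0 qu).
by move: au; rewrite /avoids/= => /negbTE ->.
Qed.

Lemma not_hit_alive Gam u w : 0 <= u -> Delta n \in Gam -> not_hit Gam u w ->
  forall t, 0 <= t -> t <= u -> alive X t w.
Proof.
move=> u0 DG /(hitting_time_gtP Gam w u0) h t t0 tu e.
by move: (h t t0 tu); rewrite e DG.
Qed.

Lemma sum_state_transient (F : state n -> R) (Gam : {set state n}) :
  Delta n \in Gam ->
  \sum_j F j * (j \notin Gam)%:R = \sum_(x : 'I_n) F (transient x) * (transient x \notin Gam)%:R.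
Proof.
by move=> DG; rewrite big_split_ord/= big_ord1 [rshift n ord0]/(Delta n) DG mulr0 addr0.
Qed.

(** As Delta lies in both sets, the indicators delete it from both sums, and between transient
    states [absorbing_Q] has the transitions of B. *)
Lemma two_step_sum k (q1 q2 : R) (Ga Gb : {set state n}) (x : 'I_n) :
  Delta n \in Ga -> Delta n \in Gb ->
  \sum_j \sum_l (expm (q1 *: absorbing_Q (B k)) (transient x) j * expm (q2 *: absorbing_Q (B k)) j l)
     * ((j \notin Ga) && (l \notin Gb))%:R =
  (expm (q1 *: B k) *m (Hmx R Ga *m (expm (q2 *: B k) *m (Hmx R Gb *m ones R n)))) x ord0.
Proof.
move=> Da Db.
under eq_bigr => j _.
  under eq_bigr => l _ do rewrite -mulnb natrM mulrACA.
  rewrite -mulr_sumr sum_state_transient//; over.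
under eq_bigr do rewrite mulrAC.
rewrite sum_state_transient// mxE; apply: eq_bigr => y _.
rewrite expm_absorbing_Q Hmx_mulE.
rewrite -mulrA; congr (_ * _); rewrite mulrC; congr (_ * _).
by rewrite [RHS]mxE; apply: eq_bigr => z _; rewrite expm_absorbing_Q Hmx_onesE.
Qed.

Lemma two_step_sum_Delta k (q1 q2 : R) (Ga Gb : {set state n}) :
  stochastically_closed B Ga -> Delta n \in Ga ->
  \sum_j \sum_l (expm (q1 *: absorbing_Q (B k)) (Delta n) j * expm (q2 *: absorbing_Q (B k)) j l)
     * ((j \notin Ga) && (l \notin Gb))%:R = 0.
Proof.
move=> cGa Da; apply: big1 => j _; apply: big1 => l _.
have [jG|jG] := boolP (j \in Ga); first by rewrite mulr0.
by rewrite (@expm_closed0 _ _ _ [pred i | i \in Ga]) ?mul0r// => i i'; exact: cGa.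
Qed.

(** Split by (phi, X_t, X_r, X_v) and use [markov_strict_past] in each cell. The cells with X_t =
    Delta contribute nothing, Delta being in the closed set [Ga]. *)
Lemma joint_avoids t r v (Ga Gb : {set state n}) (C : set T) :
  0 <= t -> t <= r -> r <= v -> strict_past X t C ->
  stochastically_closed B Ga -> Delta n \in Ga -> Delta n \in Gb ->
  P (C `&` (avoids Ga r `&` avoids Gb v)) =
  (\sum_k \sum_(x : 'I_n) P (C `&` (regime phi k `&` at_state X t (transient x))) *
    ((expm ((r - t) *: B k) *m
      (Hmx R Ga *m (expm ((v - r) *: B k) *m (Hmx R Gb *m ones R n)))) x ord0)%:E)%E.
Proof.
move=> t0 tr rv XC cGa Da Db; have r0 := le_trans t0 tr; have v0 := le_trans r0 rv.
have mC : measurable C.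
  apply: smallest_sub XC; first exact: sigma_algebra_measurable.
  by move=> _ [u [x [u0 ut ->]]]; exact: (measurable_at_state hX).
have mY k i j l : measurable (regime phi k `&` at_state X t i `&` at_state X r j `&` at_state X v l).
  do 2 (apply: measurableI; last exact: (measurable_at_state hX)).
  by apply: measurableI; [exact: (measurable_regime hX)|exact: (measurable_at_state hX)].
have YE k i j l : [set w | (phi w, X t w, (X r w, X v w)) = (k, i, (j, l))] =
    regime phi k `&` at_state X t i `&` at_state X r j `&` at_state X v l.
  apply/seteqP; split => w; first by move=> [<- <- <- <-]; do !split.
  by move=> [[[e1 e2] e3] e4]; congr (_, _, (_, _)).
rewrite (measure_fintype_partition P (Y := fun w => (phi w, X t w, (X r w, X v w)))); last 2 first.
- by apply: measurableI => //; apply: measurableI; exact: measurable_avoids.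
- by move=> [[k i] [j l]]; rewrite YE.
rewrite sum_pair_ereal sum_pair_ereal.
apply: eq_bigr => k _.
pose a i := fine (P (C `&` (regime phi k `&` at_state X t i))).
have aE i : P (C `&` (regime phi k `&` at_state X t i)) = (a i)%:E.
  rewrite fineK// fin_num_measure//; apply: measurableI => //.
  by apply: measurableI; [exact: (measurable_regime hX)|exact: (measurable_at_state hX)].
have inner i :
    (\sum_jl P (C `&` (avoids Ga r `&` avoids Gb v) `&`
       [set w | (phi w, X t w, (X r w, X v w)) = ((k, i), jl)]))%E =
    (a i * \sum_j \sum_l (expm ((r - t) *: absorbing_Q (B k)) i j *
       expm ((v - r) *: absorbing_Q (B k)) j l) * ((j \notin Ga) && (l \notin Gb))%:R)%:E.
  rewrite sum_pair_ereal.
  rewrite mulr_sumr -sumEFin; apply: eq_bigr => j _.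
  rewrite mulr_sumr -sumEFin; apply: eq_bigr => l _.
  rewrite YE; have [/andP[jG lG]|jlG] := boolP (_ && _).
    rewrite mulr1 EFinM -aE -(markov_strict_past hX)//; congr (P _).
    apply/seteqP; split => w; first by move=> [[? _] ?].
    move=> [? [[? wj] wl]]; do !split => //; rewrite /avoids/=.
      by rewrite [X r w]wj.
    by rewrite [X v w]wl.
  rewrite !mulr0 (_ : _ `&` _ = set0) ?measure0//; apply/seteqP; split => // w.
  move=> [[_ [wa wb]] [[_ wj] wl]]; move/negP: jlG; apply; move: wa wb; rewrite /avoids/=.
  by rewrite [X r w]wj [X v w]wl => -> ->.
under eq_bigr do rewrite inner.
rewrite big_split_ord/= big_ord1 [rshift n ord0]/(Delta n) two_step_sum_Delta// mulr0 adde0.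
by apply: eq_bigr => x _; rewrite aE -EFinM; congr (_ * _)%:E; exact: two_step_sum.
Qed.

End Hitting.

(** * Versions of conditional probabilities *)

Section Versions.
Context d (T : measurableType d) (R : realType) (P : probability T R) (F : set (set T)).
Hypotheses (hF : sigma_algebra setT F) (hFm : F `<=` measurable).
Implicit Types (Y : T -> R) (nu : set T -> \bar R).

(** [cond_prob P F A] is the case where [nu] sends C to P (A [&] C); a general set function allows
    versions to be added and scaled. *)
Definition is_version nu Y :=
  [/\ forall V : set (measurableTypeR R), measurable V -> F (Y @^-1` V),
      P.-integrable setT (EFin \o Y)
    & forall C, F C -> (\int[P]_(w in C) (Y w)%:E = nu C)%E].

Let TF := g_sigma_algebraType F.

Lemma F_measurableP (C : set T) : measurable (C : set TF) <-> F C.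
Proof.
split; last exact: sub_sigma_algebra.
by apply: smallest_sub.
Qed.

Lemma F_measurable_funP Y :
  (forall V : set (measurableTypeR R), measurable V -> F (Y @^-1` V)) <->
  measurable_fun setT (Y : TF -> R).
Proof.
split=> [h _ V mV|h V mV]; first by rewrite setTI; apply/F_measurableP/h.
by apply/F_measurableP; rewrite -[X in measurable X]setTI; exact: h.
Qed.

(** The set {Y' < Y} belongs to F, and on it the positive function Y - Y' has integral at most 0; so
    it is null. *)
Lemma is_version_le nu nu' Y Y' : is_version nu Y -> is_version nu' Y' ->
  (forall C, F C -> (nu C <= nu' C)%E) -> {ae P, forall w, Y w <= Y' w}.
Proof.
move=> [/F_measurable_funP mY iY YE] [/F_measurable_funP mY' iY' YE'] nule.
pose C := [set w | Y' w < Y w].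
have FC : F C.
  apply/F_measurableP.
  have := measurable_fun_ltr mY' mY measurableT (Y := [set true]) I.
  rewrite setTI; congr measurable.
have mC := hFm FC.
have iYC : P.-integrable C (EFin \o Y) by exact: integrableS iY.
have iYC' : P.-integrable C (EFin \o Y') by exact: integrableS iY'.
have mD : measurable_fun C (fun w => (Y w)%:E - (Y' w)%:E)%E.
  by have /integrableP[] := integrableB mC iYC iYC'.
have D0 : (\int[P]_(w in C) `|(Y w)%:E - (Y' w)%:E| = 0)%E.
  apply/eqP; rewrite eq_le; apply/andP; split; last exact: integral_ge0.
  rewrite (eq_integral (fun w => (Y w)%:E - (Y' w)%:E)%E); last first.
    by move=> w /[!inE] Cw; rewrite gee0_abs// -EFinB lee_fin subr_ge0 ltW.
  rewrite integralB//= YE// YE'// -(YE _ FC) -(YE' _ FC) sube_le0 ?YE// YE'//.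
  by rewrite nule.
have /(ae_eq_integral_abs P mC mD).1 := D0.
apply: filterS => w h; rewrite leNgt; apply/negP => Cw.
by have := h Cw => /= /eqP; rewrite -EFinB eqe subr_eq0 gt_eqF.
Qed.

Lemma is_version_eq nu Y Y' : is_version nu Y -> is_version nu Y' ->
  {ae P, forall w, Y w = Y' w}.
Proof.
move=> vY vY'; have h1 := is_version_le vY vY' (fun _ _ => le_refl _).
have h2 := is_version_le vY' vY (fun _ _ => le_refl _).
by apply: filterS2 h1 h2 => w a b; apply/eqP; rewrite eq_le a b.
Qed.

Lemma is_version_cst0 : is_version (fun=> 0%E) (fun=> 0).
Proof.
split; first by apply/F_measurable_funP; exact: measurable_cst.
- exact: integrable0.
- by move=> C _; rewrite integral0.
Qed.

Lemma is_versionD nu nu' Y Y' : is_version nu Y -> is_version nu' Y' ->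
  is_version (fun C => nu C + nu' C)%E (fun w => Y w + Y' w).
Proof.
move=> [/F_measurable_funP mY iY YE] [/F_measurable_funP mY' iY' YE']; split.
- by apply/F_measurable_funP; exact: measurable_funD.
- exact: integrableD iY iY'.
- move=> C FC; have mC := hFm FC; rewrite -YE// -YE'//.
  under eq_integral do rewrite EFinD.
  by rewrite integralD//; [exact: integrableS iY|exact: integrableS iY'].
Qed.

Lemma is_versionZ (c : R) nu Y : is_version nu Y ->
  is_version (fun C => nu C * c%:E)%E (fun w => Y w * c).
Proof.
move=> [/F_measurable_funP mY iY YE]; split.
- by apply/F_measurable_funP; exact: measurable_funM.
- have := integrableZr measurableT c iY; apply: eq_integrable => // w _.
- move=> C FC; have mC := hFm FC; rewrite -YE//.
  under eq_integral do rewrite EFinM.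
  by rewrite integralZr//; exact: integrableS iY.
Qed.

Lemma is_version_sum (I : finType) (nu : I -> set T -> \bar R) (Y : I -> T -> R) :
  (forall i, is_version (nu i) (Y i)) ->
  is_version (fun C => \sum_i nu i C)%E (fun w => \sum_i Y i w).
Proof.
move=> h; elim: (index_enum I) => [|i s IHs].
  rewrite [X in is_version X _](_ : _ = (fun=> 0%E)); last by apply/funext => C; rewrite big_nil.
  rewrite [X in is_version _ X](_ : _ = (fun=> 0)); first exact: is_version_cst0.
  by apply/funext => w; rewrite big_nil.
rewrite [X in is_version X _](_ : _ = (fun C => nu i C + \sum_(j <- s) nu j C)%E); last first.
  by apply/funext => C; rewrite big_cons.
rewrite [X in is_version _ X](_ : _ = (fun w => Y i w + \sum_(j <- s) Y j w)); first exact: is_versionD.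
by apply/funext => w; rewrite big_cons.
Qed.

Lemma is_version_ext nu nu' Y : (forall C, F C -> nu C = nu' C) ->
  is_version nu Y -> is_version nu' Y.
Proof. by move=> e [mY iY YE]; split => // C FC; rewrite -e// YE. Qed.

Lemma cond_prob_setT : cond_prob P F setT (fun=> 1).
Proof.
split; first by apply/F_measurable_funP; exact: measurable_cst.
- apply/integrableP; split; first exact: measurable_cst.
  by rewrite /= normr1 integral_cst//= mul1e (le_lt_trans (probability_le1 _ _))// ltry.
- by move=> C FC; rewrite integral_cst ?mul1e ?setTI//; exact: hFm.
Qed.

Lemma cond_prob_ge0 A Y : cond_prob P F A Y -> {ae P, forall w, 0 <= Y w}.
Proof. by move=> h; apply: is_version_le is_version_cst0 h _ => C _. Qed.

Lemma cond_prob_le A A' Y Y' : measurable A -> measurable A' -> A `<=` A' ->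
  cond_prob P F A Y -> cond_prob P F A' Y' -> {ae P, forall w, Y w <= Y' w}.
Proof.
move=> mA mA' AA' h h'; apply: is_version_le h h' _ => C FC; have mC := hFm FC.
by apply: le_measure; rewrite ?inE; [exact: measurableI|exact: measurableI|exact: setSI].
Qed.

(** Where V > 0 this is the quotient defining Y. Where V = 0, the bounds 0 <= N <= V force N = 0, so
    the arbitrary value of Y there does no harm. *)
Lemma cond_prob_on_mul D A D' Y V : measurable D -> measurable A -> A `&` D = D' ->
  cond_prob_on P F D A Y -> cond_prob P F D V ->
  exists2 N, cond_prob P F D' N & {ae P, forall w, N w = Y w * V w}.
Proof.
move=> mD mA <- [N [den [hN hden Y_eq]]] hV; exists N => //.
have mAD : measurable (A `&` D) by exact: measurableI.
have ND := cond_prob_le mAD mD (@subIsetr _ A D) hN hden.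
have N0 := cond_prob_ge0 hN; have denV := is_version_eq hden hV.
apply: filterS2 (filterI ND N0) (filterI denV Y_eq) => w [{}ND {}N0] [<- {}Y_eq].
have [den0|den0] := ltP 0 (den w); first by rewrite Y_eq// divfK// gt_eqF.
have e : den w = 0 by apply/eqP; rewrite eq_le den0 (le_trans N0).
by apply/eqP; rewrite e mulr0 eq_le N0 andbT -e.
Qed.

End Versions.

(** * The law with the given density *)

Section DensityLaw.
Context (R : realType) (n m : nat) (B : 'I_m -> 'M[R]_n).
Hypotheses (hQ : forall k, intensity_matrix (absorbing_Q (B k)))
  (uB : forall k, B k \in unitmx).
Context (Gam1 Gam2 : {set state n}).
Hypotheses (c1 : stochastically_closed B Gam1) (c2 : stochastically_closed B Gam2)
  (dis : forall i : 'I_n, transient i \in Gam1 -> transient i \notin Gam2).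
Context (t : R) (pit : 'cV[R]_n) (st : 'I_n -> 'I_m -> R).
Hypotheses (pit0 : forall i, 0 <= pit i ord0) (pit1 : \sum_i pit i ord0 <= 1)
  (st0 : forall i k, 0 <= st i k) (st1 : forall i, \sum_k st i k = 1).
Local Notation mR := (measurableTypeR R).
Let St k : 'M[R]_n := diag_mx (\row_i st i k).
Local Notation f := (density B Gam1 Gam2 t pit St).

Lemma weightE k i : (pit^T *m St k) ord0 i = pit i ord0 * st i k.
Proof. by rewrite mul_mx_diag !mxE. Qed.

Lemma weight_ge0 k i : 0 <= (pit^T *m St k) ord0 i.
Proof. by rewrite weightE mulr_ge0. Qed.

Lemma survfunE t1 t2 : survfun B t pit St Gam1 Gam2 t1 t2 =
  \sum_k \sum_i pit i ord0 * st i k * surv_vector B t Gam1 Gam2 k t1 t2 i ord0.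
Proof.
by apply: eq_bigr => k _; rewrite mxE; apply: eq_bigr => i _; rewrite weightE.
Qed.

Lemma point_massE : point_mass Gam1 Gam2 pit =
  1 - \sum_i pit i ord0 * ((transient i \notin Gam2)%:R * (transient i \notin Gam1)%:R).
Proof.
rewrite /point_mass -!mulmxA; congr (_ - _).
rewrite mxE; apply: eq_bigr => i _; rewrite [pit^T _ _]mxE; congr (_ * _).
by rewrite Hmx_mulE Hmx_onesE.
Qed.

Lemma point_mass_ge0 : 0 <= point_mass Gam1 Gam2 pit.
Proof.
rewrite point_massE subr_ge0 (le_trans _ pit1)//; apply: ler_sum => i _.
by rewrite ler_piMr// -natrM mulnb lern1 leq_b1.
Qed.

(** This is the total mass. At t1 = t2 = t every exponential is 1 and the regime weights sum to 1,
    which leaves the sum subtracted in [point_mass]. *)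
Lemma survfun_diag0 : survfun B t pit St Gam1 Gam2 t t + point_mass Gam1 Gam2 pit = 1.
Proof.
rewrite survfunE exchange_big/= point_massE.
suff -> : \sum_i \sum_k pit i ord0 * st i k * surv_vector B t Gam1 Gam2 k t t i ord0 =
    \sum_i pit i ord0 * ((transient i \notin Gam2)%:R * (transient i \notin Gam1)%:R).
  by rewrite addrC subrK.
apply: eq_bigr => i _.
under eq_bigr => k _.
  rewrite /surv_vector lexx subrr scale0r expm0 !mul1mx Hmx_mulE Hmx_onesE mulrAC; over.
by rewrite -mulr_sumr st1 mulr1.
Qed.

Lemma density_tt : f (t, t) = point_mass Gam1 Gam2 pit.
Proof. by rewrite /= !ltxx eqxx. Qed.

Lemma exists_density_law : exists mu : probability (mR * mR)%type R, has_density t f mu.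
Proof.
have pm0 := point_mass_ge0.
apply: exists_density_probability.
- exact: measurable_density.
- by move=> x; apply: density_ge0 => //; exact: weight_ge0.
have := integral_density_upper_right hQ uB weight_ge0 c1 c2 dis (lexx t) (lexx t) pm0.
rewrite setIid => E.
rewrite [X in (_ + X + _)%E](_ : _ = (\int[lebesgue_measure]_(u in
    [set u : mR | (t < u)%R /\ upper_right t t (u, u)]) (f (u, u))%:E)%E); last first.
  by congr (integral _ _ _); apply/seteqP; split => u /= => [tu|[]].
by rewrite E density_tt -EFinD survfun_diag0.
Qed.

Section Law.
Context (mu : probability (mR * mR)%type R).
Hypothesis hmu : has_density t f mu.

Lemma density_law_upper_right t1 t2 : t <= t1 -> t <= t2 ->
  mu (upper_right t1 t2) = (survfun B t pit St Gam1 Gam2 t1 t2)%:E.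
Proof.
move=> tt1 tt2; have [_ _ ->] := hmu; last exact: measurable_upper_right.
rewrite (integral_density_upper_right hQ uB weight_ge0 c1 c2 dis tt1 tt2 point_mass_ge0).
rewrite indicE memNset ?mulr0 ?adde0// => -[/= t1t _].
by move: (le_lt_trans tt1 t1t); rewrite ltxx.
Qed.

Lemma density_law_support : mu ([set (t, t)] `|` upper_right t t) = 1%E.
Proof.
have mS : measurable ([set (t, t)] `|` upper_right t t : set (mR * mR)).
  exact: measurable_corner.
have : mu (~` ([set (t, t)] `|` upper_right t t)) = 0%E.
  have [_ _ ->] := hmu; last exact: measurableC.
  rewrite indicE memNset; last by move=> /= []; left.
  rewrite mulr0 adde0 (_ : _ `&` _ `&` _ = set0); last first.
    by apply/seteqP; split => // x [[/= nS ur] _]; apply: nS; right.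
  rewrite (_ : [set u | _] = set0) ?integral_set0 ?adde0//.
  by apply/seteqP; split => // u /= [tu nS]; apply: nS; right.
move=> mu0; have := probability_setC mu (measurableC mS).
by rewrite setCK mu0 sube0.
Qed.

Lemma density_law_unique (mu' : probability (mR * mR)%type R) :
  mu' ([set (t, t)] `|` upper_right t t) = 1%E ->
  (forall p q : rat, 0 <= p -> 0 <= q ->
    mu' (upper_right (t + ratr p) (t + ratr q)) =
    (survfun B t pit St Gam1 Gam2 (t + ratr p) (t + ratr q))%:E) ->
  has_density t f mu'.
Proof.
move=> mu'1 mu'E; have [mf f0 muE] := hmu; split => // A mA; rewrite -muE//.
apply: (eq_probability_rat_corners mu'1 density_law_support) => // p q p0 q0.
by rewrite mu'E// density_law_upper_right// lerDl ler0q.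
Qed.

End Law.
End DensityLaw.

(** * Conditional law of the hitting times *)

Section ConditionalLaw.
Context (d : measure_display) (T : measurableType d)
  (R : realType) (P : probability T R) (n m : nat)
  (B : 'I_m -> 'M[R]_n) (p0 : 'I_n -> R) (s0 : 'I_n -> 'I_m -> R)
  (phi : T -> 'I_m) (X : R -> T -> state n) (Gam1 Gam2 : {set state n}).
Hypotheses (hX : mixture_process P B p0 s0 phi X)
  (hGam1 : stochastically_closed B Gam1) (hGam2 : stochastically_closed B Gam2)
  (DG1 : Delta n \in Gam1) (DG2 : Delta n \in Gam2).
Context (t : R) (F : set (set T)) (g : info) (a : T -> R).
Hypotheses (ht : 0 <= t) (hF : sigma_algebra setT F) (hFX : F `<=` strict_past X t)
  (ha : cond_prob P F (alive X t) a).

Let hFm : F `<=` measurable.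
Proof.
apply: subset_trans hFX _; apply: smallest_sub; first exact: sigma_algebra_measurable.
by move=> _ [u [x [u0 ut ->]]]; exact: (measurable_at_state hX).
Qed.

Lemma measurable_alive : measurable (alive X t).
Proof.
rewrite (_ : alive X t = ~` at_state X t (Delta n))//.
by apply: measurableC; exact: (measurable_at_state hX).
Qed.

(* P{X_t <> Delta | F_{t-}} or 1: the normalisation that turns F_{t-}-conditional
   probabilities into G_t-conditional ones. *)
Definition G_weight : T -> R := if g is PastOnly then fun=> 1 else a.
Definition G_event : set T := if g is PastOnly then setT else alive X t.

Lemma measurable_G_event : measurable G_event.
Proof. by rewrite /G_event; case: g; [exact: measurableT|exact: measurable_alive]. Qed.

Lemma G_weight_version : cond_prob P F G_event G_weight.
Proof. by rewrite /G_event /G_weight; case: g => //; exact: cond_prob_setT. Qed.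

Lemma G_weight_gt0 w : G_defined g a w -> 0 < G_weight w.
Proof. by rewrite /G_weight; case: g. Qed.

Lemma alive_sub_G_event : alive X t `<=` G_event.
Proof. by rewrite /G_event; case: g. Qed.

(** For A inside {X_t <> Delta} the numerator of the quotient is P{A | F} itself, so both kinds of
    information take the same form. *)
Lemma cond_prob_G_version (A : set T) (Y : T -> R) : A `<=` alive X t ->
  cond_prob_G P X t F g A Y ->
  exists V, cond_prob P F A V /\ {ae P, forall w, G_defined g a w -> Y w = V w / G_weight w}.
Proof.
move=> Aal; rewrite /cond_prob_G /G_weight; case: g => [hY|].
  by exists Y; split => //; apply: aeW => w _; rewrite divr1.
move=> [N [den [hN hden Y_eq]]]; exists N; split; first by move: hN; rewrite setIidl.
have den_a := is_version_eq hF hFm hden ha.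
by apply: filterS2 den_a Y_eq => w /= <-.
Qed.

Lemma transient_sub_alive i : at_state X t (transient i) `<=` alive X t.
Proof. by move=> w e; rewrite /alive/= e => /eqP; rewrite eq_lrshift. Qed.

(** Read as an inequality between F-conditional probabilities and divided by [G_weight], this bounds
    the sum of the pi_i(t) by 1. *)
Lemma sum_transient_le C : F C ->
  (\sum_(i : 'I_n) P (at_state X t (transient i) `&` C) <= P (G_event `&` C))%E.
Proof.
move=> FC; have mC := hFm FC.
rewrite (measure_fintype_partition P (A := G_event `&` C) (Y := X t)); first last.
- by move=> i; exact: (measurable_at_state hX).
- by apply: measurableI => //; exact: measurable_G_event.
rewrite big_split_ord/= [leLHS](eq_bigr (fun i => P (G_event `&` C `&` at_state X t (transient i)))).
  by rewrite leeDl// sume_ge0.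
move=> i _; congr (P _); apply/seteqP; split => w; last by move=> [[_ ?] ?].
by move=> [wi Cw]; do !split => //; apply: alive_sub_G_event; exact: transient_sub_alive wi.
Qed.

Definition joint_survival t1 t2 : set T := not_hit X Gam1 t1 `&` not_hit X Gam2 t2.

(** After replacing survival by the positions at t1 and t2, the earlier date is the first step of
    [joint_avoids]; this is the case split of [surv_vector]. *)
Lemma joint_survival_prob t1 t2 C : t <= t1 -> t <= t2 -> F C ->
  P (joint_survival t1 t2 `&` C) =
  (\sum_k \sum_i P (regime phi k `&` at_state X t (transient i) `&` C) *
     (surv_vector B t Gam1 Gam2 k t1 t2 i ord0)%:E)%E.
Proof.
move=> tt1 tt2 FC; have mC := hFm FC; have XC := hFX FC.
have t10 := le_trans ht tt1; have t20 := le_trans ht tt2.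
have -> : P (joint_survival t1 t2 `&` C) = P (C `&` (avoids X Gam1 t1 `&` avoids X Gam2 t2)).
  apply: eq_measure_ae.
  - by apply: measurableI => //; apply: measurableI; exact: (measurable_not_hit hX).
  - by apply: measurableI => //; apply: measurableI; exact: (measurable_avoids hX).
  apply: filterS2 (not_hit_ae hX hGam1 t10) (not_hit_ae hX hGam2 t20) => w [a1 b1] [a2 b2].
  by split; [move=> [[/a1 ? /a2 ?] ?]|move=> [? [/b1 ? /b2 ?]]]; do !split.
rewrite /surv_vector; case: leP => t21.
  rewrite (setIC (avoids X Gam1 t1)) (joint_avoids hX ht tt2 t21 XC)//.
  by apply: eq_bigr => k _; apply: eq_bigr => i _; rewrite setIC.
rewrite (joint_avoids hX ht tt1 (ltW t21) XC)//.
by apply: eq_bigr => k _; apply: eq_bigr => i _; rewrite setIC.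
Qed.

Context (pit : T -> 'cV[R]_n) (st : 'I_n -> 'I_m -> T -> R) (Fbar : R -> R -> T -> R).
Hypothesis hpit : forall i : 'I_n, cond_prob_G P X t F g
      [set w | X t w = transient i] (fun w => pit w i ord0).
Hypothesis hst : forall (i : 'I_n) (k : 'I_m), cond_prob_on P F
      [set w | X t w = transient i] [set w | phi w = k] (st i k).
Hypothesis hFbar : forall t1 t2 : R, t <= t1 -> t <= t2 -> cond_prob_G P X t F g
      [set w | (t1%:E < hitting_time X Gam1 w)%E /\
               (t2%:E < hitting_time X Gam2 w)%E] (Fbar t1 t2).

Lemma pit_ae : {ae P, forall w, G_defined g a w ->
  (forall i, 0 <= pit w i ord0) /\ \sum_i pit w i ord0 <= 1}.
Proof.
have /choice[V hV] : forall i : 'I_n, exists V, cond_prob P F (at_state X t (transient i)) V /\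
   {ae P, forall w, G_defined g a w -> pit w i ord0 = V w / G_weight w}.
  by move=> i; apply: cond_prob_G_version (hpit i); exact: transient_sub_alive.
have V0 : {ae P, forall w, forall i, 0 <= V i w}.
  by apply: filter_forall => i; apply: (cond_prob_ge0 hF hFm); exact: (hV i).1.
have VE : {ae P, forall w, forall i, G_defined g a w -> pit w i ord0 = V i w / G_weight w}.
  by apply: filter_forall => i; exact: (hV i).2.
have VS := is_version_le hF hFm (is_version_sum hF hFm (fun i => (hV i).1)) G_weight_version
  sum_transient_le.
apply: filterS3 V0 VE VS => w V0 VE VS Gw; have G0 := G_weight_gt0 Gw; split.
  by move=> i; rewrite VE// divr_ge0// ltW.
under eq_bigr do rewrite VE//.
by rewrite -mulr_suml ler_pdivrMr// mul1r.
Qed.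

(** Two versions of one F-conditional probability are compared: the numerator of [Fbar], and the
    versions N of P{phi = k, X_t = i | F} weighted by [surv_vector]. Each N is s_i^(k)(t) P{X_t = i
    | F}, and dividing by [G_weight] turns the second factor into pi_i(t). *)
Lemma Fbar_ae t1 t2 : t <= t1 -> t <= t2 -> {ae P, forall w, G_defined g a w ->
  Fbar t1 t2 w = survfun B t (pit w) (fun k => diag_mx (\row_i st i k w)) Gam1 Gam2 t1 t2}.
Proof.
move=> tt1 tt2.
have /choice[V hV] : forall i : 'I_n, exists V, cond_prob P F (at_state X t (transient i)) V /\
   {ae P, forall w, G_defined g a w -> pit w i ord0 = V w / G_weight w}.
  by move=> i; apply: cond_prob_G_version (hpit i); exact: transient_sub_alive.
have VE : {ae P, forall w, forall i, G_defined g a w -> pit w i ord0 = V i w / G_weight w}.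
  by apply: filter_forall => i; exact: (hV i).2.
have /choice[N hN] : forall ik : 'I_n * 'I_m, exists N,
    cond_prob P F (regime phi ik.2 `&` at_state X t (transient ik.1)) N /\
    {ae P, forall w, N w = st ik.1 ik.2 w * V ik.1 w}.
  move=> [i k] /=.
  have mD : measurable (at_state X t (transient i)) by exact: (measurable_at_state hX).
  have [N hN NE] := cond_prob_on_mul hF hFm mD (measurable_regime hX k) erefl (hst i k) (hV i).1.
  by exists N.
have NE : {ae P, forall w, forall ik, N ik w = st ik.1 ik.2 w * V ik.1 w}.
  by apply: filter_forall => ik; exact: (hN ik).2.
have [|U [hU UE]] := cond_prob_G_version _ (hFbar tt1 tt2).
  (* Since t <= t1 and Delta is in [Gam1], survival to t1 rules out X_t = Delta. *)
  by move=> w [h1 _]; apply: (not_hit_alive hX _ DG1 h1) => //; exact: le_trans tt1.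
have hW : is_version P F (fun C => P (joint_survival t1 t2 `&` C))
   (fun w => \sum_k \sum_i N (i, k) w * surv_vector B t Gam1 Gam2 k t1 t2 i ord0).
  apply: (is_version_ext (fun C FC => esym (joint_survival_prob tt1 tt2 FC))).
  apply: is_version_sum => // k; apply: is_version_sum => // i; apply: is_versionZ => //.
  exact: (hN (i, k)).1.
have UW := is_version_eq hF hFm hU hW.
apply: filterS2 (filterI VE NE) (filterI UE UW) => w [{}VE {}NE] [{}UE {}UW] Gw.
rewrite UE// UW survfunE mulr_suml; apply: eq_bigr => k _.
rewrite mulr_suml; apply: eq_bigr => i _.
by rewrite VE// NE/=; ring.
Qed.

End ConditionalLaw.

(** Existence of a measure dF_t is part of the conclusion, so that the statement about all such
    measures is not vacuous. *)
Theorem theorem3p11 (d : measure_display) (T : measurableType d)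
    (R : realType) (P : probability T R) (n m : nat)
    (B : 'I_m -> 'M[R]_n) (p0 : 'I_n -> R) (s0 : 'I_n -> 'I_m -> R)
    (phi : T -> 'I_m) (X : R -> T -> state n)
    (Gam1 Gam2 : {set state n})
    (hX : mixture_process P B p0 s0 phi X)
    (hGam1 : stochastically_closed B Gam1)
    (hGam2 : stochastically_closed B Gam2)
    (hGam12 : (Gam1 :&: Gam2)%SET = [set Delta n]%SET)
    (hp0 : forall i : 'I_n,
      transient i \notin Gam1 -> transient i \notin Gam2 -> p0 i != 0)
    (htau : P [set w | (0 < hitting_time X Gam1 w)%E /\
                       (0 < hitting_time X Gam2 w)%E] = 1%E)
    (t : R) (ht : 0 <= t)
    (* the information F_{t-} and G_t *)
    (F : set (set T)) (hF : sigma_algebra setT F)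
    (hFX : F `<=` strict_past X t) (g : info)
    (a : T -> R) (ha : cond_prob P F (alive X t) a)
    (* pi(t), s(t) and the conditional survival function *)
    (pit : T -> 'cV[R]_n)
    (hpit : forall i : 'I_n, cond_prob_G P X t F g
      [set w | X t w = transient i] (fun w => pit w i ord0))
    (st : 'I_n -> 'I_m -> T -> R)
    (hst : forall (i : 'I_n) (k : 'I_m), cond_prob_on P F
      [set w | X t w = transient i] [set w | phi w = k] (st i k))
    (hst1 : {ae P, forall w, forall i : 'I_n,
      (forall k : 'I_m, 0 <= st i k w) /\ \sum_k st i k w = 1})
    (Fbar : R -> R -> T -> R)
    (hFbar : forall t1 t2 : R, t <= t1 -> t <= t2 -> cond_prob_G P X t F g
      [set w | (t1%:E < hitting_time X Gam1 w)%E /\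
               (t2%:E < hitting_time X Gam2 w)%E] (Fbar t1 t2)) :
  let ft := fun w : T =>
    density B Gam1 Gam2 t (pit w) (fun k => diag_mx (\row_i st i k w)) in
  (exists mu, is_dFbar P (G_defined g a) t Fbar mu) /\
  forall mu, is_dFbar P (G_defined g a) t Fbar mu ->
    {ae P, forall w, G_defined g a w -> has_density t (ft w) (mu w)}.
Proof.
move=> ft.
have DG : Delta n \in Gam1 /\ Delta n \in Gam2.
  by apply/andP; have := finset.set11 (Delta n); rewrite -hGam12 inE.
have dis i : transient i \in Gam1 -> transient i \notin Gam2.
  move=> i1; apply/negP => i2.
  have : transient i \in [set Delta n]%SET by rewrite -hGam12 inE i1.
  by rewrite inE eq_lrshift.
have hQ k := mix_intensity hX k; have uB k := mix_nonsingular hX k.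
(* All that the analytic part uses about the conditional weights at a fixed w. *)
pose good w := [/\ forall i, 0 <= pit w i ord0, \sum_i pit w i ord0 <= 1,
  forall i k, 0 <= st i k w & forall i, \sum_k st i k w = 1].
have good_ae : {ae P, forall w, G_defined g a w -> good w}.
  have h := pit_ae hX ht hF hFX ha hpit.
  by apply: filterS2 h hst1 => w h1 h2 /h1[? ?]; split => // i; have [] := h2 i.
have hFbarE t1 t2 (tt1 : t <= t1) (tt2 : t <= t2) :=
  Fbar_ae hX hGam1 hGam2 DG.1 DG.2 ht hF hFX ha hpit hst hFbar tt1 tt2.
have /choice[mu0 mu0P] : forall w,
    exists mu : probability (measurableTypeR R * measurableTypeR R)%type R, good w -> has_density t (ft w) mu.
  move=> w; have [[h1 h2 h3 h4]|ngood] := pselect (good w).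
    by have [mu hmu] := exists_density_law hQ uB hGam1 hGam2 dis t h1 h2 h3 h4; exists mu.
  (* Outside [good] any probability may serve as the value of [mu0]. *)
  by exists (@dirac _ (measurableTypeR R * measurableTypeR R)%type (t, t) R).
split.
  exists mu0; split => [|t1 t2 tt1 tt2].
    apply: filterS good_ae => w h /h gw.
    exact: density_law_support (mu0P w gw).
  apply: filterS2 good_ae (hFbarE t1 t2 tt1 tt2) => w h Fw Gw; have gw := h Gw.
  rewrite Fw//; have [h1 h2 h3 h4] := gw.
  exact: (density_law_upper_right hQ uB hGam1 hGam2 dis h1 h2 h3 (mu0P w gw) tt1 tt2).
move=> mu [mu1 muF].
have [dec decP] : exists dec : nat -> rat * rat, forall q, exists N, dec N = q.
  by exists (fun N => odflt (0, 0) (unpickle N)) => q; exists (pickle q); rewrite pickleK.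
have muE : {ae P, forall w, forall N, 0 <= (dec N).1 -> 0 <= (dec N).2 -> G_defined g a w ->
    mu w (upper_right (t + ratr (dec N).1) (t + ratr (dec N).2)) =
    (survfun B t (pit w) (fun k => diag_mx (\row_i st i k w)) Gam1 Gam2
       (t + ratr (dec N).1) (t + ratr (dec N).2))%:E}.
  apply: ae_foralln => N; move: (dec N) => [p q] /=.
  have [p0'|p0'] := leP 0 p; last by apply: aeW.
  have [q0|q0] := leP 0 q; last by apply: aeW.
  have tp : t <= t + ratr p by rewrite lerDl ler0q.
  have tq : t <= t + ratr q by rewrite lerDl ler0q.
  by apply: filterS2 (muF _ _ tp tq) (hFbarE _ _ tp tq) => w h1 h2 _ _ Gw; rewrite h1// h2.
apply: filterS3 good_ae mu1 muE => w h h1 h2 Gw; have gw := h Gw.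
have [g1 g2 g3 g4] := gw.
apply: (density_law_unique hQ uB hGam1 hGam2 dis g1 g2 g3 (mu0P w gw) (h1 Gw)) => p q p0' q0.
by have [N E] := decP (p, q); have := h2 N; rewrite E => /(_ p0' q0 Gw).
Qed.
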